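(* Let $(E_n)_{n\in\mathbb{N}}$ be a betting sequence with drift certificate $(c_n)$, fix $t\in\mathbb{N}$ and $\alpha\in(0,1)$, and let $C_t\in\mathbb{R}$ be a constant with $\sum_{n\le t}c_n\ge C_t$ $\mathbb{P}_1$-a.s. Assume there are constants $a\in(0,\infty)$ and $K_n,w_{0,n}\in[0,\infty)$ such that, $\mathbb{P}_1$-a.s. for every $n\in\mathbb{N}$, $$\mathbb{P}_1(L_n\le c_n-x\mid\mathcal{F}_{n-1})\le K_ne^{-ax}\ \text{ for all }x\ge0,\qquad \mathbb{E}_{\mathbb{P}_1}[(L_n-c_n)^2\mid\mathcal{F}_{n-1}]\le w_{0,n}.$$ Let $K\ge\sum_{n\le t}K_n$ and $w_0\ge\sum_{n\le t}w_{0,n}$ be constants. Then, with $s_{\max}=a$: 1. $\psi_n(s):=\frac{w_{0,n}s^2}{2}+K_n\sum_{k\ge3}(\frac sa)^k=\frac{w_{0,n}s^2}{2}+\frac{K_n(s/a)^3}{1-s/a}$ is a majorant on $[0,a)$, and $\Psi^{(t)}(s)=\frac{w_0s^2}{2}+\frac{K(s/a)^3}{1-s/a}$ satisfies $\sum_{n\le t}\psi_n\le\Psi^{(t)}$ (so $(C_t,\Psi^{(t)})$ is an aggregate at horizon $t$). 2. $\displaystyle\bar\gamma_t(\alpha)\le\gamma_t(\alpha)\le\exp\Big(-\sup_{0\le s<a}\Big\{s\Delta_t-\frac{w_0s^2}{2}-\frac{K(s/a)^3}{1-s/a}\Big\}\Big).$ 3. If $\Delta_t>0$ and $K>0$, the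 supremum is attained at $s^{\ast}_t=a\,u^{\ast}$, where $u^{\ast}\in(0,1)$ is the unique root of $$a\,w_0\,u+\frac Ka\cdot\frac{u^2(3-2u)}{(1-u)^2}=\Delta_t .$$ 4. The exponent $\mathcal{E}:=\sup_{0\le s<a}\{s\Delta_t-\Psi^{(t)}(s)\}$ satisfies: if $w_0>0$ and $\Delta_t\le\frac{aw_0}{2}$, then $$\mathcal{E}\ge\frac{\Delta_t^2}{2w_0}\Big(1-\frac{4K\Delta_t}{a^3w_0^2}\Big);$$ and if $a\Delta_t>K$, then $$\mathcal{E}\ge a\Delta_t-2\sqrt{Ka\Delta_t}-\frac{a^2w_0}{2}.$$
   Context: Conventions: $\log$ is natural, $\log0=-\infty$; $(x)_+=\max\{x,0\}$. Setting: $(\Omega,\mathcal{F})$ is a measurable space with a filtration $(\mathcal{F}_t)_{t\in\mathbb{N}_0}$, $\mathcal{F}_0=\{\emptyset,\Omega\}$, and $\mathbb{P}_0,\mathbb{P}_1$ are probability measures with $\mathbb{P}_1|_{\mathcal{F}_t}\ll\mathbb{P}_0|_{\mathcal{F}_t}$ for all $t$. A betting sequence is a family of $\mathcal{F}_n$-measurable maps $E_n:\Omega\to[0,\infty]$ with $\mathbb{E}_{\mathbb{P}_0}[E_n\mid\mathcal{F}_{n-1}]\le1$ $\mathbb{P}_0$-a.s. Wealth: $W_0=1$, $W_t=\prod_{n\le t}E_n$; $L_n:=\log E_n$. For $\alpha\in(0,1)$: $\ell:=\log\frac1\alpha$, $\tau_\alpha:=\inf\{t\in\mathbb{N}:W_t>\frac1\alpha\}$,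 $\gamma_t(\alpha):=\mathbb{P}_1(W_t\le\frac1\alpha)$, $\bar\gamma_t(\alpha):=\mathbb{P}_1(\tau_\alpha>t)$; $\Delta_t:=(C_t-\ell)_+$. Drift certificate: real random variables $c_n$, $\mathcal{F}_{n-1}$-measurable, with $\mathbb{E}_{\mathbb{P}_1}[L_n\mid\mathcal{F}_{n-1}]\ge c_n$ $\mathbb{P}_1$-a.s. (conditional expectation in the extended sense, required to be well defined). Put $\varphi_n(s):=\log\mathbb{E}_{\mathbb{P}_1}[e^{-s(L_n-c_n)}\mid\mathcal{F}_{n-1}]$. Majorant on $[0,s_{\max})$: maps $\psi_n:[0,s_{\max})\times\Omega\to[0,\infty]$ with $\psi_n(s)$ $\mathcal{F}_{n-1}$-measurable, $\psi_n(0)=0$, and $\varphi_n(s)\le\psi_n(s)$ $\mathbb{P}_1$-a.s. for all $n$, $s$. Aggregate at horizon $t$: deterministic $C_t$, $\Psi^{(t)}$ with $\sum_{n\le t}c_n\ge C_t$ and $\sum_{n\le t}\psi_n(s)\le\Psi^{(t)}(s)$ $\mathbb{P}_1$-a.s. for all $s\in[0,s_{\max})$. *)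

(* Defs.v *)
From mathcomp Require Export all_boot all_order all_algebra.
From mathcomp Require Export all_classical all_reals all_analysis measurable_realfun.

Set Implicit Arguments.
Unset Strict Implicit.
Unset Printing Implicit Defensive.

Export Order.TTheory GRing.Theory Num.Theory.
Export numFieldNormedType.Exports.

Global Open Scope classical_set_scope.
Global Open Scope ring_scope.

Section Conditioning.
Context d (T : measurableType d) (R : realType).
Implicit Types (P : probability T R) (G : set (set T)) (X Y : T -> \bar R).

Definition measurable_wrt d' (U : measurableType d') G (f : T -> U) : Prop :=
  measurable_fun [set: g_sigma_algebraType G] (f : g_sigma_algebraType G -> U).

Definition is_cond_expectation0 P G X Y : Prop :=
  [/\ measurable_wrt G Y, forall w, (0 <= Y w)%E
    & forall A, G A -> (\int[P]_(w in A) Y w = \int[P]_(w in A) X w)%E].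

(* For measurable X >= 0 and a sub-sigma-algebra G a version always exists
   (Radon-Nikodym for the truncations of X, then monotone limits) and is unique
   up to P-null sets, so the default value of xget is irrelevant. *)
Definition cond_expectation0 P G X : T -> \bar R :=
  xget (cst 0%E) [set Y | is_cond_expectation0 P G X Y].

(* E_P[X | G] := E_P[X^+ | G] - E_P[X^- | G], for X valued in [-oo, +oo]; it is
   only meaningful together with cond_expectation_defined, which is automatic
   when X >= 0. *)
Definition cond_expectation P G X : T -> \bar R := fun w =>
  (cond_expectation0 P G X^\+ w - cond_expectation0 P G X^\- w)%E.

Definition cond_expectation_defined P G X : Prop :=
  {ae P, forall w,
    (cond_expectation0 P G X^\+ w +? - cond_expectation0 P G X^\- w)%E}.

Definition cond_probability P G (A : set T) : T -> \bar R :=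
  cond_expectation P G (EFin \o \1_A).

End Conditioning.

(* Sequences indexed by {1, 2, ...} are encoded as functions on nat whose value
   at 0 is never used; F is indexed by {0, 1, ...}. *)
Section Betting.
Context d (T : measurableType d) (R : realType).
Implicit Types (P : probability T R) (F : nat -> set (set T)).
Implicit Types (E : nat -> T -> \bar R) (c : nat -> T -> R).
Implicit Types (psi : nat -> R -> T -> \bar R) (alpha C : R) (t : nat).

Definition is_filtration F : Prop :=
  [/\ forall t, sigma_algebra [set: T] (F t),
      forall t, F t `<=` measurable,
      forall s t, (s <= t)%N -> F s `<=` F t
    & F 0%N = [set set0; [set: T]]].

Definition locally_dominated P1 P0 F : Prop :=
  forall t A, F t A -> P0 A = 0%E -> P1 A = 0%E.

Definition is_betting_sequence P0 F E : Prop :=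
  forall n, (0 < n)%N ->
    [/\ forall w, (0 <= E n w)%E,
        measurable_wrt (F n) (E n)
      & {ae P0, forall w, (cond_expectation P0 (F n.-1) (E n) w <= 1)%E}].

(* 0 * +oo = 0 in \bar R *)
Definition wealth E t (w : T) : \bar R :=
  (\prod_(1 <= n < t.+1) E n w)%E.

Definition log_increment E n (w : T) : \bar R := lne (E n w).

(* ereal_inf set0 = +oo *)
Definition crossing_time E alpha (w : T) : \bar R :=
  ereal_inf [set n%:R%:E | n in
    [set n : nat | (0 < n)%N /\ ((alpha^-1)%:E < wealth E n w)%E]].

Definition miss_probability P1 E alpha t : \bar R :=
  P1 [set w | (wealth E t w <= (alpha^-1)%:E)%E].

Definition late_probability P1 E alpha t : \bar R :=
  P1 [set w | (t%:R%:E < crossing_time E alpha w)%E].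

Definition excess_drift C alpha : R := Num.max (C - ln (alpha^-1)) 0.

Definition is_drift_certificate P1 F E c : Prop :=
  forall n, (0 < n)%N ->
    [/\ measurable_wrt (F n.-1) (c n),
        cond_expectation_defined P1 (F n.-1) (log_increment E n)
      & {ae P1, forall w,
          ((c n w)%:E <= cond_expectation P1 (F n.-1) (log_increment E n) w)%E}].

Definition cond_cgf P1 F E c n (s : R) (w : T) : \bar R :=
  lne (cond_expectation P1 (F n.-1)
    (fun w' => expeR ((- s)%:E * (log_increment E n w' - (c n w')%:E))%E) w).

Definition is_majorant P1 F E c (smax : \bar R) psi : Prop :=
  forall n, (0 < n)%N ->
    (forall w, psi n 0 w = 0%E) /\
    forall s, 0 <= s -> (s%:E < smax)%E ->
      [/\ forall w, (0 <= psi n s w)%E,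
          measurable_wrt (F n.-1) (psi n s)
        & {ae P1, forall w, (cond_cgf P1 F E c n s w <= psi n s w)%E}].

Definition is_aggregate P1 c (smax : \bar R) psi t C (Psi : R -> \bar R) : Prop :=
  {ae P1, forall w, C <= \sum_(1 <= n < t.+1) c n w} /\
  forall s, 0 <= s -> (s%:E < smax)%E ->
    {ae P1, forall w, (\sum_(1 <= n < t.+1) psi n s w <= Psi s)%E}.

End Betting.

Section TailMajorant.
Context (R : realType).
Implicit Types (a w K s Delta : R).

Definition tail_series w K a s : \bar R :=
  ((w * s ^+ 2 / 2)%:E + K%:E * \sum_(3 <= k <oo) ((s / a) ^+ k)%:E)%E.

Definition tail_closed w K a s : R :=
  w * s ^+ 2 / 2 + K * (s / a) ^+ 3 / (1 - s / a).

Definition tail_exponent w K a Delta : \bar R :=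
  ereal_sup [set (s * Delta - tail_closed w K a s)%:E | s in `[0, a[].

End TailMajorant.

(* Main.v *)
From HB Require Import structures.
Require Import Defs.
From mathcomp Require Import ring lra.

(** Condition on F_{n-1} and put y = c_n - L_n and u = s / a. Since
    e^(s y) <= 1 + s y + (s y)^2 / 2 for y <= 0, the only part of e^(s y) not
    controlled by the first two moments is the remainder
    g(y) = e^(s y) - 1 - s y - (s y)^2 / 2 on y > 0. By the layer-cake formula
    its conditional mean is the integral of g'(x) P(y >= x | F_{n-1}), at most
    K_n times the integral of g'(x) e^(- a x), that is K_n u^3 / (1 - u). The
    drift certificate makes the linear term nonpositive, so the conditional
    moment is at most 1 + psi_n <= e^psi_n. As psi_n is deterministic, these
    bounds multiply along the filtration, and Markov's inequality gives the
    bound on the miss probability. The claims on the exponent follow from the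
    tangent-line inequality for the convex function u^3 / (1 - u), and from
    evaluating at s = Delta / w0 and s = a (1 - sqrt (K / (a Delta))).

    Conditional statements are used in integrated form: for X >= 0, a bound
    E[X | G] <= k a.s. is equivalent to int_A X <= k P(A) for all A in G. *)

Set Implicit Arguments.
Unset Strict Implicit.
Unset Printing Implicit Defensive.

(** * Conditional expectation of nonnegative variables *)

Section CondExpectationExistence.
Local Open Scope ereal_scope.
Context d (T : measurableType d) (R : realType) (P : probability T R).
Variable G : set (set T).
Hypotheses (sG : sigma_algebra [set: T] G) (GT : G `<=` measurable).

Lemma measurable_g_sigmaP (A : set (g_sigma_algebraType G)) : measurable A <-> G A.
Proof. by rewrite /measurable/= sigma_algebra_id. Qed.

Lemma measurable_g_id :
  @measurable_fun _ _ T (g_sigma_algebraType G) [set: T] id.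
Proof. by move=> _ Y /measurable_g_sigmaP GY; rewrite setTI; exact: GT. Qed.

Lemma measurable_wrtW d' (U : measurableType d') (f : T -> U) :
  measurable_wrt G f -> measurable_fun [set: T] f.
Proof.
move=> mf.
exact: (@measurableT_comp _ _ _ T (g_sigma_algebraType G) U _ _ _ mf
  measurable_g_id).
Qed.

Lemma measurable_wrt_preimage d' (U : measurableType d') (f : T -> U) (B : set U) :
  measurable_wrt G f -> measurable B -> G (f @^-1` B).
Proof.
move=> mf mB; apply/measurable_g_sigmaP; rewrite -[X in measurable X]setTI.
exact: mf.
Qed.

(** The restriction of [P] to [G], set up as a probability on the coarser space so that
    Radon-Nikodym derivatives with respect to it are [G]-measurable. *)
Let PG (A : set (g_sigma_algebraType G)) : \bar R := P A.

Let PG0 : PG set0 = 0. Proof. exact: measure0. Qed.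

Let PG_ge0 A : 0 <= PG A. Proof. exact: measure_ge0. Qed.

Let PG_sigma_additive : semi_sigma_additive PG.
Proof.
move=> S mS tS mUS; apply: measure_semi_sigma_additive => //.
- by move=> i; apply: GT; exact/measurable_g_sigmaP.
- by apply: GT; exact/measurable_g_sigmaP.
Qed.

HB.instance Definition _ := isMeasure.Build _ _ _ PG PG0 PG_ge0 PG_sigma_additive.

Let PG_setT : PG setT = 1. Proof. exact: probability_setT. Qed.

HB.instance Definition _ := Measure_isProbability.Build _ _ _ PG PG_setT.

(** [PG] is the pushforward of [P] under the identity from [T] to the coarser space, so this is a
    change of variables. *)
Let integral_PG (Y : T -> \bar R) (A : set T) :
  measurable_wrt G Y -> (forall w, 0 <= Y w) -> G A ->
  \int[PG]_(w in A) Y w = \int[P]_(w in A) Y w.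
Proof.
move=> mY Y0 GA.
rewrite -[RHS](@ge0_integral_pushforward _ _ _ _ _ _ measurable_g_id P A Y)//.
- exact/measurable_g_sigmaP.
- exact: (@measurable_funTS _ _ (g_sigma_algebraType G)).
Qed.

Section BoundedVersion.
Variable X : T -> \bar R.
Hypotheses (mX : measurable_fun [set: T] X) (X0 : forall w, 0 <= X w).
Hypothesis X1 : forall w, X w <= 1.

Let nu (A : set (g_sigma_algebraType G)) : \bar R := \int[P]_(w in A) X w.

Let nu0 : nu set0 = 0. Proof. exact: integral_set0. Qed.

Let nu_ge0 A : 0 <= nu A. Proof. by apply: integral_ge0. Qed.

Let nu_sigma_additive : semi_sigma_additive nu.
Proof.
move=> S mS tS mUS; apply: (semi_sigma_additive_nng_induced mX X0) => //.
- by move=> i; apply: GT; exact/measurable_g_sigmaP.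
- by apply: GT; exact/measurable_g_sigmaP.
Qed.

HB.instance Definition _ := isMeasure.Build _ _ _ nu nu0 nu_ge0 nu_sigma_additive.

Let nu_le (A : set (g_sigma_algebraType G)) : measurable A -> nu A <= P A.
Proof.
move=> /measurable_g_sigmaP/GT mA; rewrite -[leRHS]mul1e -integral_cst//.
by apply: ge0_le_integral => //; exact: measurable_funTS.
Qed.

Let nu_fin : fin_num_fun nu.
Proof.
move=> A mA; rewrite ge0_fin_numE//.
apply: le_lt_trans (nu_le mA) _.
by rewrite -ge0_fin_numE// fin_num_measure//; apply: GT; exact/measurable_g_sigmaP.
Qed.

HB.instance Definition _ := Measure_isFinite.Build _ _ _ nu nu_fin.

(** The version is the density of [nu] with respect to [PG]; the bound X <= 1 gives [nu] <= P, hence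
    both finiteness and domination. *)
Lemma bounded_cond_expectation0_exists : exists Y, is_cond_expectation0 P G X Y.
Proof.
have nuP : nu `<< PG.
  apply/null_content_dominatesP => A mA PA0; apply/eqP.
  by rewrite eq_le measure_ge0 andbT (le_trans (nu_le mA))// -[P A]/(PG A) PA0.
have [Y [Y0 _ /measurable_int mY YE]] := radon_nikodym_sigma_finite nuP.
exists Y; split => // A GA.
by rewrite -integral_PG// -YE//; exact/measurable_g_sigmaP.
Qed.

End BoundedVersion.

(** The part of X between heights n and n + 1: each slice lies in [0, 1], and the slices add up to X
    even where X = +oo. *)
Let slice (X : T -> \bar R) n w := mine (X w) n.+1%:R%:E - mine (X w) n%:R%:E.

Let mine_fin (X : T -> \bar R) n w : 0 <= X w -> mine (X w) n%:R%:E \is a fin_num.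
Proof.
move=> X0; rewrite ge0_fin_numE; last by rewrite le_min X0 lee_fin ler0n.
by rewrite gt_min ltry orbT.
Qed.

Let sum_slice X w : 0 <= X w -> \sum_(n <oo) slice X n w = X w.
Proof.
move=> X0; apply/cvg_lim => //.
(* Partial sums telescope to min (X, n), which is eventually constant if X is finite and equals n if
   X = +oo. *)
rewrite (_ : (fun n => _) = fun n => mine (X w) n%:R%:E); last first.
  apply/funext => n; rewrite telescope_sume//=; last first.
    by move=> i _; exact: mine_fin.
  by rewrite [mine (X w) 0%R%:E]min_r// sube0.
case: (X w) X0 => [x x0||//]; last first.
  move=> _; under eq_fun do rewrite min_r ?leey//.
  by apply/cvgenyP; exact: cvg_id.
apply: cvg_near_cst; near=> n; rewrite min_l// lee_fin.
by near: n; exact: nbhs_infty_ger.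
Unshelve. all: by end_near. Qed.

Let slice_ge0 X n w : 0 <= X w -> 0 <= slice X n w.
Proof.
move=> X0; rewrite sube_ge0 ?mine_fin//.
by rewrite le_min !ge_min lexx lee_fin ler_nat leqnSn orbT.
Qed.

Let slice_le1 X n w : 0 <= X w -> slice X n w <= 1.
Proof.
move=> X0; rewrite leeBlDl ?mine_fin//.
have n1E : n%:R%:E + 1 = n.+1%:R%:E :> \bar R by rewrite -EFinD natr1.
have [Xn|nX] := leP (X w) n%:R%:E; last by rewrite n1E ge_min lexx orbT.
by rewrite ge_min leeDl.
Qed.

(** Versions for the bounded slices are summed; monotone convergence exchanges the series with the
    integral on both sides. *)
Lemma cond_expectation0_exists (X : T -> \bar R) :
  measurable_fun [set: T] X -> (forall w, 0 <= X w) ->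
  exists Y, is_cond_expectation0 P G X Y.
Proof.
move=> mX X0.
have mslice n : measurable_fun [set: T] (slice X n).
  apply: emeasurable_funB; apply: measurable_mine => //; exact: measurable_cst.
have /choice[Y YP] n : exists Y, is_cond_expectation0 P G (slice X n) Y.
  by apply: bounded_cond_expectation0_exists => // w;
    [exact: slice_ge0|exact: slice_le1].
exists (fun w => \sum_(n <oo) Y n w); split.
- apply: (@ge0_emeasurable_sum _ (g_sigma_algebraType G)) => [n w _ _|n _].
    by have [] := YP n.
  by have [] := YP n.
- by move=> w; apply: nneseries_ge0 => n _ _; have [] := YP n.
- move=> A GA; have mA := GT GA.
  transitivity (\int[P]_(w in A) (\sum_(n <oo) slice X n w)); last first.
    by apply: eq_integral => w _; rewrite sum_slice.
  rewrite !integral_nneseries//.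
  - by apply: eq_eseriesr => n _; have [_ _ ->] := YP n.
  - by move=> n; exact: measurable_funTS.
  - by move=> n w _; exact: slice_ge0.
  - by move=> n; apply: measurable_funTS; apply: measurable_wrtW; have [] := YP n.
  - by move=> n w _; have [] := YP n.
Qed.

Lemma cond_expectation0P (X : T -> \bar R) :
  measurable_fun [set: T] X -> (forall w, 0 <= X w) ->
  is_cond_expectation0 P G X (cond_expectation0 P G X).
Proof.
move=> mX X0; apply: (@xgetPex _ (cst 0) (is_cond_expectation0 P G X)).
exact: cond_expectation0_exists.
Qed.

(** The negative part of X is 0, but [xget] may pick any version of its conditional expectation;
    such a version is nonnegative with integral 0, hence 0 only almost surely. *)
Lemma cond_expectation_ae_eq (X : T -> \bar R) :
  measurable_fun [set: T] X -> (forall w, 0 <= X w) ->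
  {ae P, forall w, cond_expectation P G X w = cond_expectation0 P G X w}.
Proof.
move=> mX X0; rewrite /cond_expectation.
have -> : X^\+ = X by apply/funext => w; rewrite (@ge0_funeposE _ _ setT)// inE.
have -> : X^\- = cst 0 by apply/funext => w; rewrite (@ge0_funenegE _ _ setT)// inE.
have [mY Y0 /(_ setT) YE] :
    is_cond_expectation0 P G (cst 0) (cond_expectation0 P G (cst 0)).
  exact: cond_expectation0P.
have : {ae P, forall w, setT w -> cond_expectation0 P G (cst 0) w = 0}.
  apply/ae_eq_integral_abs => //; first exact: measurable_wrtW.
  under eq_integral do rewrite gee0_abs//.
  rewrite YE; first exact: integral0.
  by rewrite -(setC0); case: sG => G0 /(_ _ G0); rewrite setTD.
by apply: filterS => w /(_ I) ->; rewrite sube0.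
Qed.

(** For the converse direction, the sets where the version is at least k + 1/(n+1) belong to [G];
    testing the integrated bound on them forces each to be null, and their union is where the
    version exceeds k. *)
Lemma cond_expectation_le_cstP (X : T -> \bar R) (k : R) :
  measurable_fun [set: T] X -> (forall w, 0 <= X w) -> (0 <= k)%R ->
  {ae P, forall w, cond_expectation P G X w <= k%:E} <->
  (forall A, G A -> \int[P]_(w in A) X w <= k%:E * P A).
Proof.
move=> mX X0 k0; have [mY Y0 YE] := cond_expectation0P mX X0.
have mY' := measurable_wrtW mY.
split=> [Yk A GA|Xk].
  have mA := GT GA; rewrite -YE// -integral_cst//.
  apply: ae_ge0_le_integral => //; first exact: measurable_funTS.
  by apply: filterS2 (cond_expectation_ae_eq mX X0) Yk => w -> Yk _.
pose S n := [set w | (k + n.+1%:R^-1)%:E <= cond_expectation0 P G X w].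
have GS n : G (S n).
  rewrite (_ : S n = cond_expectation0 P G X @^-1` `[(k + n.+1%:R^-1)%:E, +oo]).
    by apply: measurable_wrt_preimage mY _; exact: emeasurable_itv.
  by apply/seteqP; split => w /=; rewrite in_itv/= leey andbT.
have PS n : P (S n) = 0.
  have mS := GT (GS n).
  have : (k + n.+1%:R^-1)%:E * P (S n) <= k%:E * P (S n).
    apply: le_trans (Xk _ (GS n)); rewrite -YE// -integral_cst//.
    apply: ge0_le_integral => //; last exact: measurable_funTS.
    by move=> w _; rewrite /= lee_fin addr_ge0.
  rewrite EFinD ge0_muleDl ?lee_fin// -[leRHS]adde0 leeD2lE.
    rewrite pmule_rle0 ?lte_fin ?invr_gt0// => PS0.
    by apply/eqP; rewrite eq_le PS0 measure_ge0.
  by rewrite fin_numM// fin_num_measure.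
have Sae : {ae P, forall w, forall n, ~ S n w}.
  apply/ae_foralln => n; exists (S n).
  by split; [exact: GT|exact: PS|move=> w /=/contrapT].
apply: filterS2 (cond_expectation_ae_eq mX X0) Sae => w -> Sw.
rewrite leNgt; apply/negP => kY.
have [n kn] : exists n, (k + n.+1%:R^-1)%:E <= cond_expectation0 P G X w.
  case: (cond_expectation0 P G X w) kY => [y|_|//]; last by exists 0%N; rewrite leey.
  (* This n satisfies n + 1 > 1 / (y - k), that is 1 / (n + 1) < y - k. *)
  rewrite lte_fin -subr_gt0 => ky; exists (Num.truncn (y - k)^-1).
  rewrite lee_fin -lerBrDl -[leRHS]invrK lef_pV2 ?posrE ?invr_gt0//.
  by rewrite ltW// truncnS_gt.
exact: (Sw n).
Qed.

End CondExpectationExistence.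

(** * The tail exponent *)

Section TailCalculus.
Context (R : realType).
Implicit Types a w K u v s D : R.

(** The derivative of [tail_closed w K a] at s = a v. *)
Definition tail_slope w K a v : R :=
  a * w * v + K / a * (v ^+ 2 * (3 - 2 * v) / (1 - v) ^+ 2).

Lemma tail_closed_scale w K a u : 0 < a ->
  tail_closed w K a (a * u) = a ^+ 2 * w * u ^+ 2 / 2 + K * u ^+ 3 / (1 - u).
Proof.
move=> a0; rewrite /tail_closed.
have -> : a * u / a = u by rewrite mulrAC divff ?mul1r ?gt_eqF.
by rewrite exprMn; congr (_ + _); ring.
Qed.

(** Since u^3 / (1 - u) = 1 / (1 - u) - 1 - u - u^2, the gap to the tangent is (u - v)^2 times an
    explicit factor, nonnegative because (1 - u) (1 - v)^2 <= 1. No differentiation is involved. *)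
Lemma tail_closed_tangent w K a u v : 0 <= w -> 0 <= K -> 0 < a ->
  0 <= u < 1 -> 0 <= v < 1 ->
  tail_slope w K a v * (a * u - a * v) <=
  tail_closed w K a (a * u) - tail_closed w K a (a * v).
Proof.
move=> w0 K0 a0 /andP[u0 u1] /andP[v0 v1]; rewrite !tail_closed_scale//.
have u1' : 0 < 1 - u by rewrite subr_gt0.
have v1' : 0 < 1 - v by rewrite subr_gt0.
rewrite -subr_ge0 /tail_slope.
have -> : a ^+ 2 * w * u ^+ 2 / 2 + K * u ^+ 3 / (1 - u) -
    (a ^+ 2 * w * v ^+ 2 / 2 + K * v ^+ 3 / (1 - v)) -
    (a * w * v + K / a * (v ^+ 2 * (3 - 2 * v) / (1 - v) ^+ 2)) *
      (a * u - a * v) =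
  (u - v) ^+ 2 * (a ^+ 2 * w / 2 + K * (((1 - u) * (1 - v) ^+ 2)^-1 - 1)).
  by field; rewrite !gt_eqF.
apply: mulr_ge0; first exact: sqr_ge0.
apply: addr_ge0; first by rewrite divr_ge0// mulr_ge0 ?sqr_ge0.
apply: mulr_ge0 => //; rewrite subr_ge0 invf_ge1 ?mulr_gt0 ?exprn_gt0//.
have u1'' : 1 - u <= 1 by rewrite lerBlDl lerDr.
have v1'' : 1 - v <= 1 by rewrite lerBlDl lerDr.
by rewrite mulr_ile1 ?exprn_ge0 ?exprn_ile1 ?(ltW u1') ?(ltW v1').
Qed.

(** The difference of the slopes is u - v times a positive factor; positivity reduces to 2 A^2 B^2 <
    A + B for A = 1 - u and B = 1 - v in (0, 1). *)
Lemma tail_slope_inj w K a u v : 0 <= w -> 0 < K -> 0 < a ->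
  0 < u < 1 -> 0 < v < 1 -> tail_slope w K a u = tail_slope w K a v -> u = v.
Proof.
move=> w0 K0 a0 /andP[u0 u1] /andP[v0 v1] /eqP; rewrite -subr_eq0 /tail_slope.
have u1' : 0 < 1 - u by rewrite subr_gt0.
have v1' : 0 < 1 - v by rewrite subr_gt0.
have -> : a * w * u + K / a * (u ^+ 2 * (3 - 2 * u) / (1 - u) ^+ 2) -
    (a * w * v + K / a * (v ^+ 2 * (3 - 2 * v) / (1 - v) ^+ 2)) =
  (u - v) * (a * w + K / a * (((1 - u) + (1 - v) -
     2 * ((1 - u) ^+ 2 * (1 - v) ^+ 2)) / ((1 - u) ^+ 2 * (1 - v) ^+ 2))).
  by field; rewrite !gt_eqF.
rewrite mulf_eq0 subr_eq0 => /orP[/eqP//|/eqP H]; exfalso; move: H.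
apply/eqP; rewrite gt_eqF//.
set A := 1 - u in u1' *; set B := 1 - v in v1' *.
have A1 : A < 1 by rewrite /A ltrBlDl ltrDr.
have B1 : B < 1 by rewrite /B ltrBlDl ltrDr.
apply: ltr_wpDl; first by rewrite mulr_ge0 ?(ltW a0).
apply: mulr_gt0; first exact: divr_gt0.
apply: divr_gt0; last by rewrite mulr_gt0 ?exprn_gt0.
rewrite subr_gt0.
have A2B2 : A ^+ 2 * B ^+ 2 <= A * B.
  rewrite -exprMn expr2 ger_pMl ?mulr_gt0//.
  by apply: mulr_ile1; exact: ltW.
have : A * B < A by rewrite gtr_pMr.
have : A * B < B by rewrite gtr_pMl.
lra.
Qed.

(** Multiplying slope minus D by (1 - v)^2 yields a polynomial with values - D at 0 and K / a at 1,
    so the intermediate value theorem applies on the closed interval despite the pole at 1. *)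
Lemma tail_slope_root w K a D : 0 <= w -> 0 < K -> 0 < a -> 0 < D ->
  exists2 u, 0 < u < 1 & tail_slope w K a u = D.
Proof.
move=> w0 K0 a0 D0.
pose p : {poly R} := (a * w) *: ('X * (1 - 'X) ^+ 2) +
  (K / a) *: ('X ^+ 2 * (3%:P - 2 *: 'X)) - D *: (1 - 'X) ^+ 2.
have pE x : p.[x] = a * w * (x * (1 - x) ^+ 2) +
    K / a * (x ^+ 2 * (3 - 2 * x)) - D * (1 - x) ^+ 2.
  by rewrite /p !hornerE.
have p0 : p.[0] = - D by rewrite pE; ring.
have p1 : p.[1] = K / a by rewrite pE; ring.
have [|x] := @poly_ivt R p 0 1 ler01.
  by rewrite p0 p1 oppr_le0 divr_ge0 ltW.
move=> /andP[x0 x1] /rootP px.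
have xn0 : x != 0.
  by apply/eqP => xE; move: px; rewrite xE p0 => /eqP; rewrite oppr_eq0 gt_eqF.
have xn1 : x != 1.
  by apply/eqP => xE; move: px; rewrite xE p1 => /eqP; rewrite gt_eqF ?divr_gt0.
have {}x0 : 0 < x by rewrite lt_neqAle eq_sym xn0.
have {}x1 : x < 1 by rewrite lt_neqAle xn1.
exists x; first by rewrite x0.
have x1' : 1 - x != 0 by rewrite subr_eq0 eq_sym.
apply/eqP; rewrite -subr_eq0; apply/eqP.
transitivity (p.[x] / (1 - x) ^+ 2); last by rewrite px mul0r.
by rewrite pE /tail_slope; field; rewrite x1' gt_eqF.
Qed.

Lemma tail_exponent_ge w K a D s : 0 <= s < a ->
  ((s * D - tail_closed w K a s)%:E <= tail_exponent w K a D)%E.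
Proof. by move=> sa; apply: ereal_sup_ubound; exists s. Qed.

(** At the critical point the tangent has slope D, so the tangent inequality says directly that no s
    does better. *)
Lemma tail_exponent_attained w K a D u : 0 <= w -> 0 <= K -> 0 < a ->
  0 < u < 1 -> tail_slope w K a u = D ->
  tail_exponent w K a D = (a * u * D - tail_closed w K a (a * u))%:E.
Proof.
move=> w0 K0 a0 /andP[u0 u1] uD; apply/eqP; rewrite eq_le; apply/andP; split.
  apply: ge_ereal_sup => y [s /=]; rewrite in_itv/= => /andP[s0 sa] <-.
  have sE : s = a * (s / a) by rewrite mulrCA divff ?mulr1 ?gt_eqF.
  have sa1 : 0 <= s / a < 1.
    by rewrite divr_ge0 ?(ltW a0)//= ltr_pdivrMr// mul1r.
  have := @tail_closed_tangent w K a (s / a) u w0 K0 a0 sa1.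
  by rewrite -sE uD (ltW u0) u1 => /(_ isT); rewrite lee_fin; lra.
apply: tail_exponent_ge.
by rewrite mulr_ge0 ?(ltW a0) ?(ltW u0)//= gtr_pMr.
Qed.

(** The choice s = D / w maximises the quadratic part; the hypothesis on D gives u <= 1/2, so 1 / (1
    - u) <= 2 and the remaining term costs at most 2 K u^3. *)
Lemma tail_exponent_small_ge w K a D : 0 < w -> 0 <= K -> 0 < a -> 0 <= D ->
  D <= a * w / 2 ->
  ((D ^+ 2 / (2 * w) * (1 - 4 * K * D / (a ^+ 3 * w ^+ 2)))%:E
    <= tail_exponent w K a D)%E.
Proof.
move=> w0 K0 a0 D0 Daw.
pose u := D / (a * w).
have u0 : 0 <= u by rewrite divr_ge0 ?mulr_ge0 ?(ltW a0) ?(ltW w0).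
have u2 : u <= 1 / 2 by rewrite ler_pdivrMr ?mulr_gt0//; lra.
have auE : a * u = D / w by rewrite /u; field; rewrite !gt_eqF.
apply: le_trans (@tail_exponent_ge w K a D (a * u) _); last first.
  by rewrite mulr_ge0 ?(ltW a0) //= gtr_pMr//; lra.
rewrite lee_fin tail_closed_scale//.
have : K * u ^+ 3 / (1 - u) <= 2 * (K * u ^+ 3).
  have K3 : 0 <= K * u ^+ 3 by rewrite mulr_ge0 ?exprn_ge0.
  by rewrite ler_pdivrMr; [nra|lra].
have -> : D ^+ 2 / (2 * w) * (1 - 4 * K * D / (a ^+ 3 * w ^+ 2)) =
    a * u * D - a ^+ 2 * w * u ^+ 2 / 2 - 2 * (K * u ^+ 3).
  by rewrite /u; field; rewrite !gt_eqF.
lra.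
Qed.

(** With s = a (1 - r) the powers of 1 - r are at most 1, which leaves the cost a D r + K / r,
    smallest at r = sqrt (K / (a D)); K < a D makes this r admissible. *)
Lemma tail_exponent_large_ge w K a D : 0 <= w -> 0 <= K -> 0 < a ->
  K < a * D ->
  ((a * D - 2 * Num.sqrt (K * a * D) - a ^+ 2 * w / 2)%:E
    <= tail_exponent w K a D)%E.
Proof.
move=> w0 K0 a0 KaD; have aD0 : 0 < a * D by exact: le_lt_trans KaD.
have D0 : 0 < D by rewrite pmulr_rgt0 in aD0.
have bound r : 0 < r <= 1 ->
    ((a * D - a * D * r - a ^+ 2 * w / 2 - K / r)%:E <= tail_exponent w K a D)%E.
  move=> /andP[r0 r1].
  apply: le_trans (@tail_exponent_ge w K a D (a * (1 - r)) _); last first.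
    by rewrite mulr_ge0 ?(ltW a0) ?subr_ge0//= gtr_pMr//; lra.
  rewrite lee_fin tail_closed_scale// opprB addrCA subrr addr0.
  have : K * (1 - r) ^+ 3 / r <= K / r.
    rewrite ler_pM2r ?invr_gt0// ler_piMr// exprn_ile1//; lra.
  have : a ^+ 2 * w * (1 - r) ^+ 2 / 2 <= a ^+ 2 * w / 2.
    rewrite ler_pM2r ?invr_gt0//; apply: ler_piMr.
      by rewrite mulr_ge0 ?sqr_ge0.
    by rewrite exprn_ile1//; lra.
  lra.
(* For K = 0 the best r would be 0, which s < a excludes; a small r reaches the bound up to any e >
   0. *)
have [K0'|Kpos] := leP K 0.
  have KE : K = 0 by apply/eqP; rewrite eq_le K0' K0.
  apply/lee_addgt0Pr => e e0.
  pose r := Num.min 1 (e / (a * D)).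
  have r0 : 0 < r by rewrite lt_min ltr01 divr_gt0.
  have r1 : r <= 1 by rewrite ge_min lexx.
  have re : a * D * r <= e.
    by rewrite mulrC -ler_pdivlMr// ge_min lexx orbT.
  rewrite -leeBlDr//; apply: le_trans (bound r _); last by rewrite r0.
  rewrite KE !mul0r sqrtr0 -EFinB lee_fin; lra.
pose r := Num.sqrt (K / (a * D)).
have r0 : 0 < r by rewrite sqrtr_gt0 divr_gt0.
have r1 : r <= 1.
  by rewrite -[leRHS]sqrtr1 ler_sqrt// ler_pdivrMr// mul1r ltW.
have r2 : r ^+ 2 = K / (a * D) by rewrite sqr_sqrtr// divr_ge0 ?ltW.
have rE : Num.sqrt (K * a * D) = a * D * r.
  apply/eqP; rewrite -(@eqrXn2 _ 2) ?sqrtr_ge0// ?mulr_ge0 ?(ltW r0) ?(ltW a0) ?(ltW D0)//.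
  rewrite sqr_sqrtr ?mulr_ge0 ?(ltW a0) ?(ltW D0)//.
  by rewrite exprMn r2; apply/eqP; field; rewrite !gt_eqF.
(* At the optimal r the two costs agree, whence the factor 2 before the square root. *)
have KrE : K / r = a * D * r.
  have -> : K = a * D * r ^+ 2 by rewrite r2; field; rewrite !gt_eqF.
  by field; rewrite gt_eqF.
have rb : 0 < r <= 1 by rewrite r0.
apply: le_trans (bound r rb).
by rewrite lee_fin rE KrE; lra.
Qed.

End TailCalculus.

(** * Exponential remainders *)

Section TailSeries.
Context (R : realType).
Implicit Types a w K s u : R.

Lemma geometric_tail3 u : 0 <= u < 1 ->
  (\sum_(3 <= k <oo) (u ^+ k)%:E = (u ^+ 3 / (1 - u))%:E)%E.
Proof.
move=> /andP[u0 u1].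
rewrite -(@nneseries_addn _ (fun k => (u ^+ k)%:E) 3%N); last first.
  by move=> i; rewrite lee_fin exprn_ge0.
have cvgS : series (geometric (u ^+ 3) u) @ \oo --> u ^+ 3 / (1 - u).
  by apply: cvg_geometric_series; rewrite ger0_norm.
apply/cvg_lim => //; apply: cvg_EFin.
  by apply: nearW => n; rewrite sumEFin.
apply: cvg_trans cvgS; apply: near_eq_cvg; near=> n.
rewrite /= sumEFin /series/=; apply: eq_bigr => i _.
by rewrite exprD mulrC.
Unshelve. all: by end_near. Qed.

Lemma tail_seriesE w K a s : 0 <= s < a ->
  tail_series w K a s = (tail_closed w K a s)%:E.
Proof.
move=> /andP[s0 sa]; have a0 : 0 < a by exact: le_lt_trans sa.
rewrite /tail_series geometric_tail3; last first.
  by rewrite divr_ge0 ?(ltW a0)//= ltr_pdivrMr// mul1r.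
by rewrite -EFinM -EFinD /tail_closed !mulrA.
Qed.

Lemma tail_closed_ge0 w K a s : 0 <= w -> 0 <= K -> 0 <= s < a ->
  0 <= tail_closed w K a s.
Proof.
move=> w0 K0 /andP[s0 sa]; have a0 : 0 < a by exact: le_lt_trans sa.
have u0 : 0 <= s / a by rewrite divr_ge0 ?(ltW a0).
have u1 : 0 <= 1 - s / a by rewrite subr_ge0 ler_pdivrMr// mul1r ltW.
apply: addr_ge0; apply: divr_ge0 => //; apply: mulr_ge0 => //.
- exact: sqr_ge0.
- exact: exprn_ge0.
Qed.

Lemma sum_tail_closed_le (W Kn : nat -> R) w K a s t : 0 <= s < a ->
  \sum_(1 <= n < t.+1) W n <= w -> \sum_(1 <= n < t.+1) Kn n <= K ->
  \sum_(1 <= n < t.+1) tail_closed (W n) (Kn n) a s <= tail_closed w K a s.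
Proof.
move=> /andP[s0 sa] Ww KK; have a0 : 0 < a by exact: le_lt_trans sa.
have u0 : 0 <= s / a by rewrite divr_ge0 ?(ltW a0).
have u1 : 0 <= (1 - s / a)^-1.
  by rewrite invr_ge0 subr_ge0 ler_pdivrMr// mul1r ltW.
rewrite /tail_closed big_split/= -!mulr_suml lerD//.
  by rewrite !ler_wpM2r ?invr_ge0 ?sqr_ge0.
by rewrite !ler_wpM2r ?exprn_ge0.
Qed.

End TailSeries.

Section ExpRemainder.
Context (R : realType).
Implicit Types a s x y : R.
Local Notation mu := (@lebesgue_measure R).

(** The second-order Taylor remainder of e^(s x) at 0, and below it its derivative in x. *)
Definition exp_remainder2 s x : R := expR (s * x) - 1 - s * x - (s * x) ^+ 2 / 2.
Definition exp_remainder1 s x : R := s * (expR (s * x) - 1 - s * x).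

Lemma exp_remainder1_ge0 s x : 0 <= s -> 0 <= exp_remainder1 s x.
Proof.
by move=> s0; rewrite mulr_ge0//; have := expR_ge1Dx (s * x); lra.
Qed.

Lemma is_derive_exp_remainder2 s x :
  is_derive x 1 (exp_remainder2 s) (exp_remainder1 s x).
Proof.
apply: is_derive_eq.
by rewrite /exp_remainder1 /GRing.scale/= mulr0; field.
Qed.

Lemma exp_remainder2_0 s : exp_remainder2 s 0 = 0.
Proof. by rewrite /exp_remainder2 mulr0 expR0; ring. Qed.

Lemma is_derive_continuous (F f : R -> R) :
  (forall x, is_derive x 1 F (f x)) -> continuous F.
Proof.
by move=> Ff x; apply: differentiable_continuous; apply/derivable1_diffP;
  have [] := Ff x.
Qed.

Lemma continuous_exp_remainder1 s : continuous (exp_remainder1 s).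
Proof.
apply: (@is_derive_continuous _ (fun x => s * (s * expR (s * x) - s))) => x.
rewrite /exp_remainder1; apply: is_derive_eq; rewrite /GRing.scale/=; ring.
Qed.

(** The remainder vanishes at 0 and has a nonnegative derivative, so the mean value theorem on
    [x, 0] gives the sign. *)
Lemma exp_remainder2_le0 s x : 0 <= s -> x <= 0 -> exp_remainder2 s x <= 0.
Proof.
move=> s0 x0; have cF := is_derive_continuous (is_derive_exp_remainder2 s).
have [c _] := @MVT_segment R (exp_remainder2 s) (exp_remainder1 s) x 0 x0
  (fun y _ => is_derive_exp_remainder2 s y) (continuous_subspaceT cF).
rewrite exp_remainder2_0 !sub0r => H.
by rewrite -oppr_ge0 H mulr_ge0 ?exp_remainder1_ge0// oppr_ge0.
Qed.

Lemma integral_0y_derive (F f : R -> R) y : 0 <= y ->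
  (forall x, is_derive x 1 F (f x)) -> continuous f ->
  (\int[mu]_(x in `[0%R, y]) (f x)%:E = (F y - F 0)%:E)%E.
Proof.
rewrite le_eqVlt => /predU1P[<- _ _|y0 Ff cf].
  by rewrite set_itv1 integral_set1 subrr.
have cF := is_derive_continuous Ff.
rewrite EFinB; apply: continuous_FTC2 => //.
- exact: continuous_subspaceT.
- split => [x _| |]; first by have [] := Ff x.
  + exact/cvg_at_right_filter/cF.
  + exact/cvg_at_left_filter/cF.
- by move=> x _; rewrite derive1E; have [_] := Ff x.
Qed.

(** The fundamental theorem on [0, n] and monotone convergence; an upper bound on F replaces the
    computation of its limit at infinity. *)
Lemma integral_0oo_derive_le (F f : R -> R) M :
  (forall x, is_derive x 1 F (f x)) -> continuous f ->
  (forall x, 0 <= f x) -> (forall x, 0 <= x -> F x <= M) ->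
  (\int[mu]_(x in `[0%R, +oo[) (f x)%:E <= (M - F 0)%:E)%E.
Proof.
move=> Ff cf f0 FM.
have mf : measurable_fun [set: R] f by exact: continuous_measurable_fun.
pose S n : set R := [set` `[0%R, n%:R]].
have -> : [set` `[0%R, +oo[] = \bigcup_n S n.
  apply/seteqP; split => x /=.
    rewrite in_itv/= andbT => x0; exists (Num.truncn x).+1 => //=.
    by rewrite /S/= in_itv/= x0 ltW// truncnS_gt.
  by move=> [n _]; rewrite /S/= !in_itv/= andbT => /andP[].
have cvgI : (\int[mu]_(x in S n) (f x)%:E @[n --> \oo] -->
    \int[mu]_(x in \bigcup_n S n) (f x)%:E)%E.
  apply: ge0_nondecreasing_set_cvg_integral.
  - apply/nondecreasing_seqP => n; apply/subsetPset => x; rewrite /S/= ?in_itv/=.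
    by move=> /andP[-> /le_trans]; apply; rewrite ler_nat.
  - by move=> n; exact: measurable_itv.
  - by move=> n; apply/measurable_EFinP; exact: measurable_funTS.
  - by move=> n x _; rewrite lee_fin.
rewrite -(cvg_lim _ cvgI)//; apply: lime_le; first by apply/cvg_ex; eexists; exact: cvgI.
apply: nearW => n; rewrite integral_0y_derive//.
by rewrite lee_fin lerB ?FM.
Qed.

(** Term by term, the Taylor series of the integrand integrates to the sum of (s / a)^k over k >= 3.
    The proof uses a closed antiderivative instead of the series. *)
Lemma integral_exp_remainder1_le s a : 0 <= s < a ->
  (\int[mu]_(x in `[0%R, +oo[) (exp_remainder1 s x * expR (- (a * x)))%:E
   <= ((s / a) ^+ 3 / (1 - s / a))%:E)%E.
Proof.
move=> /andP[s0 sa]; have a0 : 0 < a by exact: le_lt_trans sa.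
have as0 : 0 < a - s by rewrite subr_gt0.
(* An antiderivative obtained by integrating s (e^(s x) - 1 - s x) e^(- a x) termwise; it is
   nonpositive on [0, +oo[, so M = 0 is allowed and - F 0 is the bound. *)
pose F x := s * (- (expR ((s - a) * x) / (a - s)) + expR (- a * x) / a +
  s * ((x / a + a^-2) * expR (- a * x))).
have F0 : 0 - F 0 = (s / a) ^+ 3 / (1 - s / a).
  rewrite /F !mulr0 expR0 mul0r add0r; field.
  by rewrite !gt_eqF// divr_gt0.
rewrite -F0; apply: integral_0oo_derive_le.
- move=> x; apply: is_derive_eq.
  rewrite /GRing.scale/=.
  have -> : (s - a) * x = s * x + - a * x by ring.
  rewrite expRD mulNr /exp_remainder1.
  by field; rewrite !gt_eqF.
- move=> x; apply: cvgM; first exact: continuous_exp_remainder1.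
  apply: (@continuous_comp _ _ _ (fun x => - (a * x)) expR).
    by apply: cvgN; apply: cvgM; [exact: cvg_cst|exact: cvg_id].
  exact: continuous_expR.
- by move=> x; rewrite mulr_ge0 ?exp_remainder1_ge0 ?expR_ge0.
- move=> x x0; rewrite /F mulr_ge0_le0//.
  have -> : (s - a) * x = s * x + - a * x by ring.
  rewrite expRD.
  (* Grouping e^(s x) with 1 + s x makes the sign visible through e^z >= 1 + z. *)
  have -> : - (expR (s * x) * expR (- a * x) / (a - s)) + expR (- a * x) / a +
      s * ((x / a + a^-2) * expR (- a * x)) =
    expR (- a * x) * (- ((expR (s * x) - (1 + s * x)) / (a - s)
      + s ^+ 2 * (1 + a * x) / (a ^+ 2 * (a - s)))).
    by field; rewrite !gt_eqF.
  rewrite mulr_ge0_le0 ?expR_ge0// oppr_le0 addr_ge0//.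
    by rewrite divr_ge0 ?(ltW as0)// subr_ge0 expR_ge1Dx.
  rewrite divr_ge0 ?mulr_ge0 ?sqr_ge0 ?(ltW as0) ?addr_ge0 ?mulr_ge0 ?(ltW a0)//.
Qed.

End ExpRemainder.

(** * Layer-cake formula *)

Section LayerCake.
Local Open Scope ereal_scope.
Context d (T : measurableType d) (R : realType) (P : probability T R).
Local Notation mu := (@lebesgue_measure R).
Variables (y : T -> R) (Z : T -> \bar R) (h : R -> R).
Hypotheses (my : measurable_fun [set: T] y) (mZ : measurable_fun [set: T] Z).
Hypotheses (Z0 : forall w, 0 <= Z w).
Hypotheses (mh : measurable_fun [set: R] h) (h0 : forall x, (0 <= h x)%R).

Let S : set (T * R) := [set z | (0 <= z.2)%R /\ (z.2 <= y z.1)%R].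

Let mS : measurable S.
Proof.
have -> : S = ([set: T * R] `&` [set z | (0 <= z.2)%R]) `&`
    ([set: T * R] `&` [set z | (z.2 <= y z.1)%R]).
  by rewrite !setTI; apply/seteqP; split => z.
apply: measurableI; apply: measurable_fun_le => //.
by apply: measurableT_comp => //; exact: measurable_fst.
Qed.

(** The integrand for Tonelli: its sections in either variable give the two sides of
    [layer_cake]. *)
Let f (z : T * R) := Z z.1 * ((h z.2)%:E * (\1_S z)%:E).

Let f0 z : 0 <= f z. Proof. by rewrite !mule_ge0 ?lee_fin. Qed.

Let mf : measurable_fun [set: T * R] f.
Proof.
apply: emeasurable_funM; first exact: measurableT_comp.
apply: emeasurable_funM.
  by apply/measurable_EFinP; exact: measurableT_comp.
by apply/measurable_EFinP; exact: measurable_indic.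
Qed.

Let integral_f x : (0 <= x)%R -> \int[P]_w f (w, x) =
  (h x)%:E * \int[P]_(w in [set w | (x <= y w)%R]) Z w.
Proof.
move=> x0; rewrite [in RHS]integral_mkcond -ge0_integralZl ?lee_fin//.
- apply: eq_integral => w _; rewrite /f/= patchE indicE.
  have -> : ((w, x) \in S) = (w \in [set w | (x <= y w)%R]).
    by apply/idP/idP; rewrite !inE /S/=; [case|].
  by case: ifP; rewrite ?mule1 ?mule0// muleC.
- apply/(measurable_restrictT Z) => //; last exact: measurable_funTS.
  rewrite -[X in measurable X]setTI; exact: measurable_fun_le.
- by move=> w _; rewrite patchE; case: ifP.
Qed.

Lemma measurable_layer :
  measurable_fun (`[0%R, +oo[%classic : set (measurableTypeR R))
  (fun x => (h x)%:E * \int[P]_(w in [set w | (x <= y w)%R]) Z w).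
Proof.
apply: (@eq_measurable_fun _ _ _ _ _ (fun x => \int[P]_w f (w, x))).
  by move=> x; rewrite inE/= in_itv/= andbT; exact: integral_f.
apply: measurable_funTS.
exact: (@measurable_fun_fubini_tonelli_G _ _ _ _ _ P f mf f0).
Qed.

(** Tonelli's theorem on the region 0 <= x <= y w. Where y w < 0 the inner interval is empty, so
    only the positive part of y counts. The weight [Z] serves both as the indicator of a
    conditioning event and as a random factor. *)
Lemma layer_cake :
  \int[P]_w (Z w * \int[mu]_(x in `[0%R, y w]) (h x)%:E) =
  \int[mu]_(x in `[0%R, +oo[) ((h x)%:E * \int[P]_(w in [set w | (x <= y w)%R]) Z w).
Proof.
transitivity (\int[P]_w \int[mu]_x f (w, x)).
  apply: eq_integral => w _.
  rewrite integral_mkcond -ge0_integralZl//.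
  - apply: eq_integral => x _; rewrite /f/= patchE indicE.
    have -> : ((w, x) \in S) = (x \in [set` `[0%R, y w]]).
      by apply/idP/idP; rewrite !inE /S/= in_itv/= => /andP.
    by case: ifP; rewrite ?mule1 ?mule0.
  - apply/(measurable_restrictT (EFin \o h)) => //; apply/measurable_EFinP.
    exact: measurable_funTS.
  - by move=> x _; rewrite patchE; case: ifP; rewrite lee_fin.
rewrite (@fubini_tonelli _ _ _ _ _ P mu f mf f0) [RHS]integral_mkcond.
apply: eq_integral => x _; rewrite patchE; case: ifPn => x0.
  by apply: integral_f; move: x0; rewrite inE/= in_itv/= andbT.
apply: integral0_eq => w _; rewrite /f/= indicE memNset ?mule0// => -[/= x0' _].
by move/negP: x0; apply; rewrite inE/= in_itv/= x0'.
Qed.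

End LayerCake.

(** * One-step exponential moment *)

Section ExponentialMoment.
Local Open Scope ereal_scope.
Context d (T : measurableType d) (R : realType) (P : probability T R).
Local Notation mu := (@lebesgue_measure R).
Variables (y : T -> R) (A : set T) (s a K w : R).
Hypotheses (my : measurable_fun [set: T] y) (mA : measurable A).
Hypotheses (sa : (0 <= s < a)%R) (K0 : (0 <= K)%R) (w0 : (0 <= w)%R).

Lemma exp_remainder2_funrpos_integral x : (0 <= s)%R ->
  \int[mu]_(z in `[0%R, x]) (exp_remainder1 s z)%:E =
  (exp_remainder2 s (Num.max x 0))%:E.
Proof.
move=> s0; have [x0|x0] := leP 0%R x.
  rewrite (@integral_0y_derive _ _ _ _ x0 (is_derive_exp_remainder2 s)).
    by rewrite exp_remainder2_0 subr0.
  exact: continuous_exp_remainder1.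
by rewrite set_itv_ge ?integral_set0 ?exp_remainder2_0// bnd_simp -ltNge.
Qed.

(** The layer-cake formula with weight 1_A exposes P (A and x <= y), where the exponential tail
    bound is inserted under the integral. *)
Lemma exp_remainder2_integral_le :
  (forall x, (0 <= x)%R ->
    P (A `&` [set z | (x <= y z)%R]) <= (K * expR (- (a * x)))%:E * P A) ->
  \int[P]_(z in A) (exp_remainder2 s (Num.max (y z) 0))%:E <=
  (K * (s / a) ^+ 3 / (1 - s / a))%:E * P A.
Proof.
move=> tail; have /andP[s0 _] := sa.
have mh : measurable_fun [set: R] (exp_remainder1 s).
  by apply: continuous_measurable_fun; exact: continuous_exp_remainder1.
have me : measurable_fun [set: R] (fun x => expR (- (a * x))).
  by apply: measurableT_comp => //; apply: measurable_funN; exact: measurable_funM.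
have h0 x := exp_remainder1_ge0 x s0.
have mZ : measurable_fun [set: T] (fun z => (\1_A z : R)%:E).
  by apply/measurable_EFinP; exact: measurable_indic.
have Z0 z : 0 <= (\1_A z : R)%:E by rewrite lee_fin.
rewrite integral_mkcond.
rewrite [leLHS](_ : _ = \int[P]_z ((\1_A z)%:E *
    \int[mu]_(x in `[0%R, y z]) (exp_remainder1 s x)%:E)); last first.
  apply: eq_integral => z _; rewrite exp_remainder2_funrpos_integral// patchE indicE.
  by case: ifP; rewrite ?mul1e ?mul0e.
rewrite (layer_cake P my mZ Z0 mh h0).
apply: (@le_trans _ _ (\int[mu]_(x in `[0%R, +oo[)
    ((K%:E * P A) * (exp_remainder1 s x * expR (- (a * x)))%:E))).
  apply: ge0_le_integral => //.
  - move=> x _; rewrite mule_ge0 ?lee_fin//; apply: integral_ge0 => z _.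
    by rewrite lee_fin.
  - exact: measurable_layer.
  - apply: emeasurable_funM => //; apply/measurable_EFinP.
    by apply: measurable_funTS; exact: measurable_funM.
  - move=> x; rewrite /= in_itv/= andbT => x0.
    rewrite integral_indic//; last first.
      by rewrite -[X in measurable X]setTI; exact: measurable_fun_le.
    rewrite [leRHS](_ : _ = (exp_remainder1 s x)%:E *
      ((K * expR (- (a * x)))%:E * P A)).
      by apply: lee_wpmul2l; rewrite ?lee_fin// tail.
    by rewrite !EFinM [LHS]muleC -[LHS]muleA; congr (_ * _); rewrite muleCA muleA.
rewrite ge0_integralZl//.
- rewrite [leRHS](_ : _ = K%:E * P A * ((s / a) ^+ 3 / (1 - s / a))%:E).
    by apply: lee_wpmul2l; [rewrite mule_ge0|exact: integral_exp_remainder1_le].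
  by rewrite -mulrA EFinM muleAC.
- by apply/measurable_EFinP; apply: measurable_funTS; exact: measurable_funM.
- by move=> x _; rewrite lee_fin mulr_ge0 ?expR_ge0.
- by rewrite mule_ge0.
Qed.

(** The drift hypothesis compares positive and negative parts so that every integral has a
    nonnegative integrand. *)
Lemma exp_moment_le :
  (forall x, (0 <= x)%R ->
    P (A `&` [set z | (x <= y z)%R]) <= (K * expR (- (a * x)))%:E * P A) ->
  \int[P]_(z in A) ((y z) ^+ 2)%:E <= w%:E * P A ->
  \int[P]_(z in A) (Num.max (y z) 0)%:E <= \int[P]_(z in A) (Num.max (- y z) 0)%:E ->
  \int[P]_(z in A) (expR (s * y z))%:E <= (1 + tail_closed w K a s)%:E * P A.
Proof.
move=> tail sq drift; have /andP[s0 _] := sa.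
have mp : measurable_fun A (fun z => (Num.max (y z) 0)%:E).
  by apply/measurable_EFinP/measurable_funTS; exact: measurable_maxr.
have mn : measurable_fun A (fun z => (Num.max (- y z) 0)%:E).
  apply/measurable_EFinP/measurable_funTS; apply: measurable_maxr => //.
  exact: measurable_funN.
have m2 : measurable_fun A (fun z => (y z ^+ 2)%:E).
  by apply/measurable_EFinP/measurable_funTS; exact: measurable_funX.
have me : measurable_fun A (fun z => (expR (s * y z))%:E).
  apply/measurable_EFinP/measurable_funTS; apply: measurableT_comp => //.
  exact: measurable_funM.
have mg : measurable_fun A (fun z => (exp_remainder2 s (Num.max (y z) 0))%:E).
  apply/measurable_EFinP/measurable_funTS.
  apply: (@measurableT_comp _ _ _ _ _ _ (exp_remainder2 s)).
    apply: continuous_measurable_fun.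
    exact: is_derive_continuous (is_derive_exp_remainder2 s).
  exact: measurable_maxr.
have g0 x : (0 <= exp_remainder2 s (Num.max x 0))%R.
  rewrite -lee_fin -exp_remainder2_funrpos_integral//; apply: integral_ge0 => z _.
  by rewrite lee_fin exp_remainder1_ge0.
(* Finiteness comes from max (- y, 0) <= 1 + y^2; it permits adding s times this integral to both
   sides and cancelling it afterwards. *)
have qfin : \int[P]_(z in A) (Num.max (- y z) 0)%:E \is a fin_num.
  rewrite ge0_fin_numE; last by apply: integral_ge0 => z _; rewrite lee_fin le_max lexx orbT.
  apply: (@le_lt_trans _ _ (\int[P]_(z in A) (1 + (y z ^+ 2)%:E))).
    apply: ge0_le_integral => //.
    - by move=> z _; rewrite lee_fin le_max lexx orbT.
    - exact: emeasurable_funD.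
    - by move=> z _; rewrite -EFinD lee_fin ge_max; nra.
  rewrite ge0_integralD//; last by move=> z _; rewrite lee_fin sqr_ge0.
  rewrite integral_cst// mul1e lte_add_pinfty//.
    by rewrite -ge0_fin_numE// fin_num_measure.
  by rewrite (le_lt_trans sq)// -ge0_fin_numE ?mule_ge0 ?lee_fin// fin_numM// fin_num_measure.
rewrite -(leeD2rE (x := s%:E * \int[P]_(z in A) (Num.max (- y z) 0)%:E)); last first.
  by rewrite fin_numM.
rewrite -ge0_integralZl//; last by move=> z _; rewrite lee_fin le_max lexx orbT.
rewrite -ge0_integralD//; last 2 first.
- by move=> z _; rewrite mule_ge0 ?lee_fin// le_max lexx orbT.
- exact: emeasurable_funM.
have mp' : measurable_fun A (fun z => s%:E * (Num.max (y z) 0)%:E).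
  exact: emeasurable_funM.
have m2' : measurable_fun A (fun z => (s ^+ 2 / 2)%:E * (y z ^+ 2)%:E).
  exact: emeasurable_funM.
have p0 z : 0 <= s%:E * (Num.max (y z) 0)%:E.
  by rewrite mule_ge0 ?lee_fin// le_max lexx orbT.
have q0 z : 0 <= (s ^+ 2 / 2)%:E * (y z ^+ 2)%:E.
  by rewrite mule_ge0 ?lee_fin ?sqr_ge0// divr_ge0 ?sqr_ge0.
(* Pointwise, this is an equality for y >= 0; for y < 0 it is the nonpositivity of the Taylor
   remainder. *)
apply: (@le_trans _ _ (\int[P]_(z in A) (1 + s%:E * (Num.max (y z) 0)%:E +
   (s ^+ 2 / 2)%:E * (y z ^+ 2)%:E + (exp_remainder2 s (Num.max (y z) 0))%:E))).
  apply: ge0_le_integral => //.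
  - by move=> z _; rewrite adde_ge0 ?mule_ge0 ?lee_fin ?expR_ge0// le_max lexx orbT.
  - by apply: emeasurable_funD => //; exact: emeasurable_funM.
  - by do 3 apply: emeasurable_funD => //.
  - move=> z _; rewrite -!EFinM -!EFinD lee_fin.
    have [y0|/ltW y0] := leP 0%R (y z).
      rewrite max_r ?oppr_le0// /exp_remainder2; lra.
    rewrite max_l ?oppr_ge0// exp_remainder2_0.
    by have := exp_remainder2_le0 s0 y0; rewrite /exp_remainder2; lra.
rewrite ge0_integralD//; last 3 first.
- by move=> z _; rewrite !adde_ge0.
- by do 2 apply: emeasurable_funD => //.
- by move=> z _; rewrite lee_fin.
rewrite ge0_integralD//; last 2 first.
- by move=> z _; rewrite adde_ge0.
- by apply: emeasurable_funD.
rewrite ge0_integralD// integral_cst// mul1e.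
have p1 z : 0 <= (Num.max (y z) 0)%:E by rewrite lee_fin le_max lexx orbT.
have n1 z : 0 <= (Num.max (- y z) 0)%:E by rewrite lee_fin le_max lexx orbT.
have s20 : (0 <= s ^+ 2 / 2)%R by rewrite divr_ge0 ?sqr_ge0.
rewrite !ge0_integralZl//; last by move=> z _; rewrite lee_fin sqr_ge0.
have rem := exp_remainder2_integral_le tail.
rewrite [leRHS](_ : _ = P A + s%:E * \int[P]_(z in A) (Num.max (- y z) 0)%:E +
  (s ^+ 2 / 2)%:E * (w%:E * P A) + (K * (s / a) ^+ 3 / (1 - s / a))%:E * P A).
  apply: leeD => //; apply: leeD; last by rewrite lee_wpmul2l// lee_fin divr_ge0 ?sqr_ge0.
  by apply: leeD => //; rewrite lee_wpmul2l.
have PAfin : P A \is a fin_num by rewrite fin_num_measure.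
rewrite -(fineK PAfin) -(fineK qfin) -!EFinM -!EFinD; congr (_%:E).
rewrite /tail_closed; ring.
Qed.

End ExponentialMoment.

(** * Certified increments *)

Section ExtendedExpLog.
Local Open Scope ereal_scope.
Context (R : realType).

Lemma measurable_lne : measurable_fun [set: \bar R] (@lne R).
Proof.
have lneE : @lne R =
    (fun x => if x <= 0 then -oo else if x == +oo then +oo else (ln (fine x))%:E).
  apply/funext => -[r||]/=; rewrite ?lee_fin ?leNye ?leye_eq//. 
rewrite lneE; apply: measurable_fun_ifT.
- apply: (measurable_fun_bool true); rewrite setTI.
  rewrite (_ : _ @^-1` _ = [set` `]-oo, 0]]); first exact: emeasurable_itv.
  by apply/seteqP; split => x /=; rewrite in_itv.
- exact: measurable_cst.
- apply: measurable_fun_ifT.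
  + apply: (measurable_fun_bool true); rewrite setTI.
    rewrite (_ : _ @^-1` _ = [set +oo]); first exact: emeasurable_set1.
    by apply/seteqP; split => x /= /eqP.
  + exact: measurable_cst.
  + apply/measurable_EFinP; apply: (@measurableT_comp _ _ _ _ _ _ (@ln R)) => //.
Qed.

Lemma measurable_expeR : measurable_fun [set: \bar R] (@expeR R).
Proof.
have expeRE : @expeR R = (fun x => if x == -oo then 0 else
    if x == +oo then +oo else (expR (fine x))%:E).
  by apply/funext => -[r||].
rewrite expeRE; apply: measurable_fun_ifT.
- apply: (measurable_fun_bool true); rewrite setTI.
  rewrite (_ : _ @^-1` _ = [set -oo]); first exact: emeasurable_set1.
  by apply/seteqP; split => x /= /eqP.
- exact: measurable_cst.
- apply: measurable_fun_ifT.
  + apply: (measurable_fun_bool true); rewrite setTI.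
    rewrite (_ : _ @^-1` _ = [set +oo]); first exact: emeasurable_set1.
    by apply/seteqP; split => x /= /eqP.
  + exact: measurable_cst.
  + apply/measurable_EFinP; apply: (@measurableT_comp _ _ _ _ _ _ (@expR R)) => //.
Qed.

Lemma le_lne : {homo @lne R : x y / x <= y}.
Proof.
move=> x y xy; have [x0|x0] := leP x 0; first by rewrite le0_lneNy// leNye.
have y0 : 0 < y by exact: lt_le_trans xy.
by rewrite lee_lne// in_itv/= leey ltW.
Qed.

End ExtendedExpLog.

Section OneStep.
Local Open Scope ereal_scope.
Context d (T : measurableType d) (R : realType) (P : probability T R).
Variables (G : set (set T)) (L : T -> \bar R) (c : T -> R) (a K v : R).
Hypotheses (sG : sigma_algebra [set: T] G) (GT : G `<=` measurable).
Hypotheses (mL : measurable_fun [set: T] L) (mc : measurable_wrt G c).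
Hypotheses (K0 : (0 <= K)%R) (v0 : (0 <= v)%R).
Hypothesis tail : forall x, (0 <= x)%R -> {ae P, forall w,
  cond_probability P G [set w' | L w' <= (c w' - x)%:E] w
    <= (K * expR (- (a * x)))%:E}.
Hypothesis sq : {ae P, forall w,
  cond_expectation P G (fun w' => (L w' - (c w')%:E) ^+ 2) w <= v%:E}.
Hypothesis drift : {ae P, forall w, (c w)%:E <= cond_expectation P G L w}.

(** [fine] replaces infinite values of L by 0, which matters only on a null set by
    [certified_increment_fin]. *)
Let y w := (c w - fine (L w))%R.

Let mc' : measurable_fun [set: T] c.
Proof. exact: measurable_wrtW mc. Qed.

Let my : measurable_fun [set: T] y.
Proof. by apply: measurable_funB => //; exact: measurableT_comp. Qed.

Let mLc : measurable_fun [set: T] (fun w => L w - (c w)%:E).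
Proof. by apply: emeasurable_funB => //; exact/measurable_EFinP. Qed.

Let sq_int A : G A -> \int[P]_(w in A) ((L w - (c w)%:E) ^+ 2) <= v%:E * P A.
Proof.
have mX : measurable_fun [set: T] (fun w => (L w - (c w)%:E) ^+ 2).
  by under eq_fun do rewrite expe2; exact: emeasurable_funM.
have X0 w : 0 <= (L w - (c w)%:E) ^+ 2 by rewrite sqre_ge0.
by apply: (cond_expectation_le_cstP P sG GT mX X0 v0).1.
Qed.

Let GsetT : G setT.
Proof. by rewrite -setC0; case: sG => G0 /(_ _ G0); rewrite setTD. Qed.

(** Taking the whole space as conditioning event, the square of L - c has a finite integral, while
    it is +oo wherever L is infinite. *)
Lemma certified_increment_fin : {ae P, forall w, L w \is a fin_num}.
Proof.
have : P.-integrable setT (fun w => (L w - (c w)%:E) ^+ 2).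
  apply/integrableP; split.
    under eq_fun do rewrite expe2; exact: emeasurable_funM.
  under eq_integral do rewrite gee0_abs ?sqre_ge0//.
  by rewrite (le_lt_trans (sq_int GsetT))// probability_setT mule1 ltry.
move=> /integrable_ae-/(_ measurableT); apply: filterS => w /(_ I).
by case: (L w) => [r||].
Qed.

Let sq_int' A : G A -> \int[P]_(w in A) ((y w) ^+ 2)%:E <= v%:E * P A.
Proof.
move=> GA; apply: le_trans (sq_int GA); apply: ae_ge0_le_integral => //.
- exact: GT.
- by move=> w _; rewrite lee_fin sqr_ge0.
- apply/measurable_EFinP/measurable_funTS; exact: measurable_funX.
- by move=> w _; rewrite sqre_ge0.
- apply: measurable_funTS; under eq_fun do rewrite expe2; exact: emeasurable_funM.
- apply: filterS certified_increment_fin => w + _; rewrite /y.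
  case: (L w) => [r||]//= _.
  by rewrite -EFinD -EFinM lee_fin -expr2 -sqrrN opprB.
Qed.

Let tail' A x : G A -> (0 <= x)%R ->
  P (A `&` [set w | (x <= y w)%R]) <= (K * expR (- (a * x)))%:E * P A.
Proof.
move=> GA x0; have mA := GT GA.
have mB : measurable [set w' | L w' <= (c w' - x)%:E].
  rewrite -[X in measurable X]setTI; apply: measurable_lee => //.
  by apply/measurable_EFinP; exact: measurable_funB.
have mS : measurable [set w | (x <= y w)%R].
  by rewrite -[X in measurable X]setTI; exact: measurable_fun_le.
set B := [set w' | L w' <= (c w' - x)%:E] in mB.
have mX : measurable_fun [set: T] (fun w => (\1_B w : R)%:E).
  by apply/measurable_EFinP; exact: measurable_indic.
have X0 w : 0 <= (\1_B w : R)%:E by rewrite lee_fin.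
have k0 : (0 <= K * expR (- (a * x)))%R by rewrite mulr_ge0 ?expR_ge0.
apply: le_trans ((cond_expectation_le_cstP P sG GT mX X0 k0).1 (tail x0) A GA).
rewrite setIC -integral_indic//; apply: ae_ge0_le_integral => //.
- by apply/measurable_EFinP/measurable_funTS; exact: measurable_indic.
- exact: measurable_funTS.
- apply: filterS certified_increment_fin => w Lfin _.
  rewrite lee_fin !indicE; case: (boolP (w \in _)) => [|_]; last by rewrite ler0n.
  rewrite inE/= /y => xy; rewrite mem_set//.
  by rewrite /B/= -(fineK Lfin) lee_fin; lra.
Qed.

(** Integrability of [c] is not assumed, so A is confined to a region where it is bounded; together
    with the second moment this makes the integrals to be cancelled finite. *)
Let drift' A (m : R) : G A -> (forall w, A w -> `|c w| <= m)%R ->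
  \int[P]_(w in A) (Num.max (y w) 0)%:E <= \int[P]_(w in A) (Num.max (- y w) 0)%:E.
Proof.
move=> GA cm; have mA := GT GA.
have mLp := measurable_funepos mL; have mLn := measurable_funeneg mL.
have [mU U0 UE] := cond_expectation0P P sG GT mLp (fun w => funepos_ge0 L w).
have [mV V0 VE] := cond_expectation0P P sG GT mLn (fun w => funeneg_ge0 L w).
set U := cond_expectation0 P G L^\+ in mU U0 UE.
set V := cond_expectation0 P G L^\- in mV V0 VE.
have mU' : measurable_fun A U by apply: measurable_funTS; exact: measurable_wrtW mU.
have mV' : measurable_fun A V by apply: measurable_funTS; exact: measurable_wrtW mV.
have mcp : measurable_fun A (fun w => (Num.max (c w) 0)%:E).
  by apply/measurable_EFinP/measurable_funTS; exact: measurable_maxr.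
have mcn : measurable_fun A (fun w => (Num.max (- c w) 0)%:E).
  apply/measurable_EFinP/measurable_funTS; apply: measurable_maxr => //.
  exact: measurable_funN.
have myp : measurable_fun A (fun w => (Num.max (y w) 0)%:E).
  by apply/measurable_EFinP/measurable_funTS; exact: measurable_maxr.
have myn : measurable_fun A (fun w => (Num.max (- y w) 0)%:E).
  apply/measurable_EFinP/measurable_funTS; apply: measurable_maxr => //.
  exact: measurable_funN.
have mLpA : measurable_fun A L^\+ by exact: measurable_funTS.
have mLnA : measurable_fun A L^\- by exact: measurable_funTS.
have m0 w : A w -> 0 <= (m *+ 2 + 1)%:E.
  by move=> /cm mw; rewrite lee_fin addr_ge0// mulrn_wge0// (le_trans _ mw).
have max0 (r : R) : 0 <= (Num.max r 0)%:E by rewrite lee_fin le_max lexx orbT.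
(* The drift inequality c <= U - V, rearranged into sums of nonnegative terms before integrating. *)
have VcU : \int[P]_(w in A) (V w + (Num.max (c w) 0)%:E) <=
    \int[P]_(w in A) (U w + (Num.max (- c w) 0)%:E).
  apply: ae_ge0_le_integral => //.
  - by move=> w _; rewrite adde_ge0.
  - exact: emeasurable_funD.
  - by move=> w _; rewrite adde_ge0.
  - exact: emeasurable_funD.
  - apply: filterS drift => w; rewrite /cond_expectation -/U -/V => cUV _.
    have := U0 w; have := V0 w; move: cUV.
    case: (V w) => [q||]; case: (U w) => [p||]//=; rewrite ?leey// => cUV _ _.
    rewrite -EFinB lee_fin in cUV; rewrite -!EFinD lee_fin.
    by have [c0|c0] := leP 0%R (c w); [rewrite [in leRHS]max_r ?oppr_le0//; lra|
      rewrite [in leRHS]max_l ?oppr_ge0 ?(ltW c0)//; lra].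
rewrite !ge0_integralD// VE// UE// in VcU.
(* The identity y = c - L, rearranged in the same way. *)
have bal : \int[P]_(w in A) (L^\+ w + (Num.max (- c w) 0)%:E + (Num.max (y w) 0)%:E) =
    \int[P]_(w in A) (L^\- w + (Num.max (c w) 0)%:E + (Num.max (- y w) 0)%:E).
  apply: ge0_ae_eq_integral => //.
  - by do 2 apply: emeasurable_funD => //.
  - by do 2 apply: emeasurable_funD => //.
  - by move=> w _; rewrite !adde_ge0.
  - by move=> w _; rewrite !adde_ge0.
  - apply: filterS certified_increment_fin => w + _; rewrite /y funeposE funenegE.
    case: (L w) => [r||]//= _; rewrite -!EFin_max -!EFinD; congr _%:E.
    have posneg (x : R) : (Num.max x 0 = x + Num.max (- x) 0)%R.
      by have [x0|x0] := leP 0%R x; [rewrite max_r ?oppr_le0// addr0|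
        rewrite max_l ?oppr_ge0 ?(ltW x0)// subrr].
    rewrite (posneg r) (posneg (c w)) (posneg (c w - r)%R); ring.
rewrite !ge0_integralD// in bal; last 4 first.
- by move=> w _; rewrite adde_ge0.
- exact: emeasurable_funD.
- by move=> w _; rewrite adde_ge0.
- exact: emeasurable_funD.
have Lpfin : \int[P]_(w in A) L^\+ w + \int[P]_(w in A) (Num.max (- c w) 0)%:E
    \is a fin_num.
  rewrite -ge0_integralD// ge0_fin_numE; last first.
    by apply: integral_ge0 => w _; rewrite adde_ge0.
  apply: (@le_lt_trans _ _ (\int[P]_(w in A) ((m *+ 2 + 1)%:E + (y w ^+ 2)%:E))).
    apply: ae_ge0_le_integral => //.
    - by move=> w _; rewrite adde_ge0.
    - exact: emeasurable_funD.
    - by move=> w Aw; rewrite adde_ge0 ?m0 ?lee_fin ?sqr_ge0//; exact: m0 Aw.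
    - by apply: emeasurable_funD => //; apply/measurable_EFinP/measurable_funTS;
        exact: measurable_funX.
    - apply: filterS certified_increment_fin => w + /cm; rewrite /y funeposE.
      case: (L w) => [r||]//= _; rewrite ler_norml => /andP[mc1 mc2].
      rewrite -EFin_max -!EFinD lee_fin.
      have rp : (Num.max r 0 <= m + 1 + (c w - r) ^+ 2)%R.
        have := sqr_ge0 (c w - r)%R; have := sqr_ge0 (c w - r + 1)%R.
        by rewrite ge_max; nra.
      have cn : (Num.max (- c w) 0 <= m)%R by rewrite ge_max; lra.
      by move: rp cn; lra.
  rewrite ge0_integralD//; last 2 first.
  - by move=> w _; rewrite lee_fin sqr_ge0.
  - by apply/measurable_EFinP/measurable_funTS; exact: measurable_funX.
  rewrite integral_cst//; apply: lte_add_pinfty.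
    by rewrite ltey_eq fin_numM// fin_num_measure.
  by rewrite (le_lt_trans (sq_int' GA))// ltey_eq fin_numM// fin_num_measure.
rewrite -(leeD2lE _ _ Lpfin) bal; exact: leeD.
Qed.

Let exp_moment_bounded A (m s : R) : G A -> (forall w, A w -> `|c w| <= m)%R ->
  (0 <= s < a)%R ->
  \int[P]_(w in A) (expR (s * y w))%:E <= (1 + tail_closed v K a s)%:E * P A.
Proof.
move=> GA cm sa; apply: exp_moment_le => //; first exact: GT.
- by move=> x; exact: tail'.
- exact: sq_int'.
- exact: drift' cm.
Qed.

(** The bound on c is removed by exhausting A with the sets where |c| <= n; these lie in [G] because
    c is [G]-measurable, and monotone convergence passes to A. *)
Lemma certified_exp_moment_le A (s : R) : G A -> (0 <= s < a)%R ->
  \int[P]_(w in A) (expR (s * (c w - fine (L w))))%:E <=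
    (1 + tail_closed v K a s)%:E * P A.
Proof.
move=> GA sa; have mA := GT GA.
pose S n := A `&` [set w | `|c w| <= n%:R]%R.
have GS n : G (S n).
  apply: ((measurable_g_sigmaP sG _).1 (@measurableI _ (g_sigma_algebraType G) _ _
    ((measurable_g_sigmaP sG _).2 GA) ((measurable_g_sigmaP sG _).2 _))).
  rewrite (_ : [set w | _] = c @^-1` [set` `[- n%:R, n%:R]%R]).
    apply: (measurable_wrt_preimage sG mc); exact: measurable_itv.
  by apply/seteqP; split => w /=; rewrite in_itv/= ler_norml.
have AE : A = \bigcup_n S n.
  rewrite -setI_bigcupr; apply/seteqP; split => w; last by case.
  move=> Aw; split => //; exists (Num.truncn `|c w|).+1 => //=.
  by rewrite ltW// truncnS_gt.
have mexp : measurable_fun [set: T] (fun w => (expR (s * (c w - fine (L w))))%:E).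
  apply/measurable_EFinP; apply: measurableT_comp => //.
  exact: measurable_funM.
have cvgI : \int[P]_(w in S n) (expR (s * (c w - fine (L w))))%:E @[n --> \oo] -->
    \int[P]_(w in \bigcup_n S n) (expR (s * (c w - fine (L w))))%:E.
  apply: ge0_nondecreasing_set_cvg_integral.
  - apply/nondecreasing_seqP => n; apply/subsetPset; apply: setIS => w /=.
    by move=> /le_trans; apply; rewrite ler_nat.
  - by move=> n; exact: GT.
  - by move=> n; exact: measurable_funTS.
  - by move=> n w _; rewrite lee_fin expR_ge0.
rewrite [in leLHS]AE -(cvg_lim _ cvgI)//.
apply: lime_le; first by apply/cvg_ex; eexists; exact: cvgI.
apply: nearW => n; apply: le_trans (exp_moment_bounded (m := n%:R) (GS n) _ sa) _.
  by move=> w [].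
apply: lee_wpmul2l; first by rewrite lee_fin addr_ge0 ?tail_closed_ge0.
by apply: le_measure; rewrite ?inE//; [exact: GT|exact: subIsetl].
Qed.

(** The integrated moment bound is turned back into an almost sure one, and ln (1 + x) <= x
    finishes. *)
Lemma certified_cgf_le (s : R) : (0 <= s < a)%R ->
  {ae P, forall w, lne (cond_expectation P G
    (fun w' => expeR ((- s)%:E * (L w' - (c w')%:E))) w)
      <= (tail_closed v K a s)%:E}.
Proof.
move=> sa; have psi0 := tail_closed_ge0 v0 K0 sa.
pose Z w := expeR ((- s)%:E * (L w - (c w)%:E)).
have mZ : measurable_fun [set: T] Z.
  apply: (@measurableT_comp _ _ _ _ _ _ (@expeR R)); first exact: measurable_expeR.
  exact: emeasurable_funM.
have Z0 w : 0 <= Z w by exact: expeR_ge0.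
have k0 : (0 <= 1 + tail_closed v K a s)%R by rewrite addr_ge0.
have ZP A : G A -> \int[P]_(w in A) Z w <= (1 + tail_closed v K a s)%:E * P A.
  move=> GA; apply: le_trans (certified_exp_moment_le GA sa).
  apply: ae_ge0_le_integral => //.
  - exact: GT.
  - exact: measurable_funTS.
  - apply/measurable_EFinP/measurable_funTS; apply: measurableT_comp => //.
    exact: measurable_funM.
  - apply: filterS certified_increment_fin => w + _; rewrite /Z.
    by case: (L w) => [r||]//= _; rewrite lee_fin ler_expR; lra.
apply: filterS ((cond_expectation_le_cstP P sG GT mZ Z0 k0).2 ZP) => w Yw.
apply: le_trans (le_lne Yw) _; rewrite EFinD; apply: le_lne1Dx.
change ((- 1)%:E <= (tail_closed v K a s)%:E); rewrite lee_fin; lra.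
Qed.

End OneStep.

(** * Wealth process *)

Section PredictableFactor.
Local Open Scope ereal_scope.
Context d (T : measurableType d) (R : realType) (P : probability T R).

Lemma measurable_wrtS d' (U : measurableType d') (G H : set (set T)) (f : T -> U) :
  sigma_algebra [set: T] G -> sigma_algebra [set: T] H -> G `<=` H ->
  measurable_wrt G f -> measurable_wrt H f.
Proof.
move=> sG sH GH mf _ B mB; rewrite setTI; apply/(measurable_g_sigmaP sH)/GH.
by apply: (measurable_wrt_preimage sG mf).
Qed.

(** Pulls a [G]-measurable factor out of the integral: with h = 1 the layer-cake formula slices M
    into its superlevel sets, which lie in [G], and the hypothesis applies to each of them. *)
Lemma predictable_integral_le (G : set (set T)) (X M : T -> R) (k : R) :
  sigma_algebra [set: T] G -> G `<=` measurable ->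
  measurable_fun [set: T] X -> (forall w, 0 <= X w)%R ->
  measurable_wrt G M -> (forall w, 0 <= M w)%R -> (0 <= k)%R ->
  (forall A, G A -> \int[P]_(w in A) (X w)%:E <= k%:E * P A) ->
  \int[P]_w (M w * X w)%:E <= k%:E * \int[P]_w (M w)%:E.
Proof.
move=> sG GT mX X0 mM M0 k0 XP; have mM' := measurable_wrtW sG GT mM.
have m1 : measurable_fun [set: R] (cst 1%R : R -> R) by exact: measurable_cst.
have len w : \int[@lebesgue_measure R]_(x in `[0%R, M w]) (cst 1%R x : R)%:E = (M w)%:E.
  rewrite /cst/= integral_cst// mul1e. rewrite [LHS]lebesgue_measure_itv/= lte_fin.
  by have := M0 w; rewrite le_eqVlt => /predU1P[<-|->]; rewrite ?ltxx// sube0.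
have cake (Z : T -> R) : measurable_fun [set: T] Z -> (forall w, 0 <= Z w)%R ->
    \int[P]_w (M w * Z w)%:E = \int[@lebesgue_measure R]_(x in `[0%R, +oo[)
      (1%:E * \int[P]_(w in [set w | (x <= M w)%R]) (Z w)%:E).
  move=> mZ Z0; rewrite -(@layer_cake _ _ _ P M (EFin \o Z) (cst 1%R))//.
  - by apply: eq_integral => w _; rewrite len muleC.
  - exact/measurable_EFinP.
rewrite cake// (_ : \int[P]_w (M w)%:E = \int[P]_w (M w * 1)%:E); last first.
  by apply: eq_integral => w _; rewrite mulr1.
have mlayer (Z : T -> R) : measurable_fun [set: T] Z -> (forall w, 0 <= Z w)%R ->
    measurable_fun (`[0%R, +oo[%classic : set (measurableTypeR R))
      (fun x => 1%:E * \int[P]_(w in [set w | (x <= M w)%R]) (Z w)%:E).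
  move=> mZ Z0; apply: (@measurable_layer _ _ _ P M (EFin \o Z) (cst 1%R)) => //.
  exact/measurable_EFinP.
have layer0 (Z : T -> R) (x : R) : (forall w, 0 <= Z w)%R ->
    0 <= 1%:E * \int[P]_(w in [set w | (x <= M w)%R]) (Z w)%:E.
  by move=> Z0; rewrite mul1e; apply: integral_ge0 => w _; rewrite lee_fin.
rewrite (cake (cst 1%R))// -ge0_integralZl//; last 2 first.
- exact: mlayer.
- by move=> x _; exact: layer0.
apply: ge0_le_integral => //.
- by move=> x _; exact: layer0.
- exact: mlayer.
- by apply: emeasurable_funM; [exact: measurable_cst|exact: mlayer].
- move=> x _; rewrite !mul1e.
  have GM : G [set w | (x <= M w)%R].
    rewrite (_ : [set w | _] = M @^-1` [set` `[x, +oo[%R]).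
      by apply: (measurable_wrt_preimage sG mM); exact: measurable_itv.
    by apply/seteqP; split => w /=; rewrite in_itv/= andbT.
  rewrite /cst/= integral_cst ?mul1e; [exact: XP|exact: GT].
Qed.

End PredictableFactor.

Section WealthBound.
Local Open Scope ereal_scope.
Context d (T : measurableType d) (R : realType) (P : probability T R).
Variables (F : nat -> set (set T)) (E : nat -> T -> \bar R) (c : nat -> T -> R).
Hypothesis hF : is_filtration F.
Hypothesis E0 : forall n w, (0 < n)%N -> 0 <= E n w.
Hypothesis mE : forall n, (0 < n)%N -> measurable_wrt (F n) (E n).
Hypothesis mc : forall n, (0 < n)%N -> measurable_wrt (F n.-1) (c n).
Hypothesis Lfin : forall n, (0 < n)%N ->
  {ae P, forall w, log_increment E n w \is a fin_num}.

Lemma measurable_wealth t : measurable_fun [set: T] (wealth E t).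
Proof.
elim: t => [|t IH].
  rewrite (_ : wealth E 0 = cst 1); first exact: measurable_cst.
  by apply/funext => w; rewrite /wealth big_geq.
rewrite (_ : wealth E t.+1 = fun w => wealth E t w * E t.+1 w).
  apply: emeasurable_funM => //; have [sF FT _ _] := hF.
  exact: (measurable_wrtW (sF t.+1) (FT t.+1) (mE (n:=t.+1) isT)).
by apply/funext => w; rewrite /wealth big_nat_recr.
Qed.

(** Crossing after t means no crossing at any time from 1 to t, in particular none at t itself; t >
    0 puts t in that range. *)
Lemma late_le_miss alpha t : (0 < t)%N ->
  late_probability P E alpha t <= miss_probability P E alpha t.
Proof.
move=> t0.
have mle n : measurable [set w | wealth E n w <= (alpha^-1)%:E].
  rewrite -[X in measurable X]setTI.
  by apply: emeasurable_fun_infty_c => //; exact: measurable_wealth.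
have lateE : [set w | t%:R%:E < crossing_time E alpha w] =
    \bigcap_n (if (0 < n <= t)%N then [set w | wealth E n w <= (alpha^-1)%:E] else setT).
  apply/seteqP; split => w /=.
    move=> tw n _; case: ifP => // /andP[n0 nt] /=; rewrite leNgt; apply/negP => Wn.
    move: tw; apply/negP; rewrite -leNgt; apply: le_trans (_ : n%:R%:E <= _).
      by apply: ereal_inf_lbound; exists n.
    by rewrite lee_fin ler_nat.
  (* Crossing times are integers, so t + 1 is a lower bound for the infimum; this yields the strict
     inequality, also when no crossing occurs. *)
  move=> H; apply: (@lt_le_trans _ _ t.+1%:R%:E); first by rewrite lte_fin ltr_nat.
  apply: le_ereal_inf_tmp => _ [n [n0 Wn] <-]; rewrite lee_fin ler_nat ltnNge.
  apply/negP => nt; have := H n I; rewrite n0 nt/=.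
  by rewrite leNgt Wn.
apply: le_measure; rewrite ?inE//.
- rewrite lateE; apply: bigcapT_measurable => n; case: ifP => // _.
- by rewrite lateE => w /(_ t I); rewrite t0 leqnn.
Qed.

Let S n w := (\sum_(1 <= k < n.+1) (c k w - fine (log_increment E k w)))%R.

Let mS n : measurable_wrt (F n) (S n).
Proof.
have [sF FT Fmono _] := hF.
elim: n => [|n IH].
  rewrite (_ : S 0 = cst 0%R); first exact: measurable_cst.
  by apply/funext => w; rewrite /S big_geq.
rewrite (_ : S n.+1 = fun w => S n w + (c n.+1 w - fine (log_increment E n.+1 w)))%R.
  apply: (@measurable_funD _ (g_sigma_algebraType (F n.+1))).
    exact: (measurable_wrtS (sF n) (sF n.+1) (Fmono _ _ (leqnSn n)) IH).
  apply: (@measurable_funB _ (g_sigma_algebraType (F n.+1))).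
    exact: (measurable_wrtS (sF n) (sF n.+1) (Fmono _ _ (leqnSn n)) (mc (n:=n.+1) isT)).
  apply: (@measurableT_comp _ _ _ (g_sigma_algebraType (F n.+1))) => //.
  apply: (@measurableT_comp _ _ _ (g_sigma_algebraType (F n.+1))); last exact: mE.
  exact: measurable_lne.
by apply/funext => w; rewrite /S big_nat_recr.
Qed.

Variable s : R.
Hypothesis s0 : (0 <= s)%R.
Variable psi : nat -> R.
Hypothesis psi0 : forall n, (0 < n)%N -> (0 <= psi n)%R.
Hypothesis step : forall n A, (0 < n)%N -> F n.-1 A ->
  \int[P]_(w in A) (expR (s * (c n w - fine (log_increment E n w))))%:E
    <= (1 + psi n)%:E * P A.

(** By induction: e^(s S_n) is measurable for [F n], the sigma-algebra on which step n + 1 is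
    conditioned, so it factors out, and 1 + psi <= e^psi turns the product into a sum of
    exponents. *)
Lemma exp_sum_le n : \int[P]_w (expR (s * S n w))%:E <=
  (expR (\sum_(1 <= k < n.+1) psi k))%:E.
Proof.
have [sF FT Fmono _] := hF.
elim: n => [|n IH].
  rewrite big_geq// expR0; under eq_integral do rewrite /S big_geq// mulr0 expR0.
  rewrite integral_cst// mul1e. exact: probability_le1.
rewrite [leLHS](_ : _ = \int[P]_w (expR (s * S n w) *
    expR (s * (c n.+1 w - fine (log_increment E n.+1 w))))%:E); last first.
  by apply: eq_integral => w _; rewrite /S big_nat_recr//= mulrDr expRD.
have mM : measurable_wrt (F n) (fun w => expR (s * S n w)).
  apply: (@measurableT_comp _ _ _ (g_sigma_algebraType (F n))) => //.
  by apply: (@measurable_funM _ (g_sigma_algebraType (F n))); [exact: measurable_cst|exact: mS].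
have mX : measurable_fun [set: T]
    (fun w => expR (s * (c n.+1 w - fine (log_increment E n.+1 w)))).
  apply: measurableT_comp => //; apply: measurable_funM => //.
  apply: measurable_funB; first exact: (measurable_wrtW (sF n) (FT n) (mc (n:=n.+1) isT)).
  apply: measurableT_comp => //; apply: measurableT_comp; first exact: measurable_lne.
  exact: (measurable_wrtW (sF n.+1) (FT n.+1) (mE (n:=n.+1) isT)).
apply: le_trans (predictable_integral_le (k := (1 + psi n.+1)%R) (sF n) (FT n) mX _ mM _ _ _) _.
- by move=> w; exact: expR_ge0.
- by move=> w; exact: expR_ge0.
- by rewrite addr_ge0 ?psi0.
- by move=> A FA; exact: step.
rewrite big_nat_recr//= expRD EFinM muleC.
apply: lee_pmul => //.
- by apply: integral_ge0 => w _; rewrite lee_fin expR_ge0.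
- by rewrite lee_fin addr_ge0 ?psi0.
- by rewrite lee_fin expR_ge1Dx.
Qed.

(** Finite logarithms exclude the values 0 and +oo of each factor, so the product never meets 0 *
    +oo. *)
Lemma wealth_expR w t : (forall n, (0 < n)%N -> log_increment E n w \is a fin_num) ->
  wealth E t w = (expR (\sum_(1 <= k < t.+1) fine (log_increment E k w)))%:E.
Proof.
move=> Lw; elim: t => [|t IH]; first by rewrite /wealth !big_geq// expR0.
rewrite [in RHS]big_nat_recr//= expRD EFinM -IH /wealth big_nat_recr//=.
congr (_ * _); have := Lw t.+1 isT; rewrite /log_increment => Lf.
have {1}<- : expeR (lne (E t.+1 w)) = E t.+1 w.
  by apply/eqP; rewrite lneK_eq E0.
by rewrite -{1}(fineK Lf).
Qed.

Lemma miss_le_exp alpha C t : (0 < alpha)%R ->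
  {ae P, forall w, C <= \sum_(1 <= n < t.+1) c n w}%R ->
  miss_probability P E alpha t <=
  (expR (- (s * excess_drift C alpha - \sum_(1 <= k < t.+1) psi k)))%:E.
Proof.
move=> al0 hC; rewrite /excess_drift; set l := ln _.
have mB : measurable [set w | wealth E t w <= (alpha^-1)%:E].
  rewrite -[X in measurable X]setTI.
  by apply: emeasurable_fun_infty_c => //; exact: measurable_wealth.
(* Without excess drift the claimed bound is at least 1, because every [psi] is nonnegative. *)
have [Cl|Cl] := leP (C - l)%R 0%R.
  rewrite mulr0 sub0r opprK; apply: le_trans (probability_le1 _ mB) _.
  rewrite lee_fin -expR0 ler_expR big_nat; apply: sumr_ge0 => k /andP[k0 _].
  exact: psi0.
have mexp : measurable_fun [set: T] (fun w => (expR (s * S t w))%:E).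
  apply/measurable_EFinP; apply: measurableT_comp => //; apply: measurable_funM => //.
  have [sF FT _ _] := hF; exact: (measurable_wrtW (sF t) (FT t) (@mS t)).
(* Markov's inequality: on the miss event the log-increments sum to at most l while the c's sum to
   at least C, so S_t >= C - l. *)
have : (expR (s * (C - l)))%:E * P [set w | wealth E t w <= (alpha^-1)%:E] <=
    \int[P]_w (expR (s * S t w))%:E.
  rewrite -(setIT [set w | wealth E t w <= _]) -integral_indic// -ge0_integralZl//; last first.
    by apply/measurable_EFinP; exact: measurable_indic.
  apply: ae_ge0_le_integral => //.
  - apply: emeasurable_funM; first exact: measurable_cst.
    by apply/measurable_EFinP; exact: measurable_indic.
  - have Lall : {ae P, forall w, forall n, (0 < n)%N -> log_increment E n w \is a fin_num}.
      apply/ae_foralln => n; case: (posnP n) => [->|n0]; first exact: aeW.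
      by apply: filterS (Lfin n0) => w.
    apply: filterS2 hC Lall => w Cw Lw _.
    rewrite indicE; case: (boolP (w \in _)) => [|_]; last by rewrite mule0 lee_fin expR_ge0.
    have aE : (alpha^-1 = expR l)%R by rewrite /l lnK// posrE invr_gt0.
    rewrite inE/= wealth_expR// lee_fin aE ler_expR mule1 lee_fin ler_expR => Wl.
    rewrite ler_wpM2l// /S sumrB; lra.
move=> /le_trans/(_ (exp_sum_le t)).
rewrite opprB expRD -lee_pdivlMl ?expR_gt0// => /le_trans; apply.
by rewrite -EFinM lee_fin expRN mulrC.
Qed.

End WealthBound.

(** * Majorant, miss probability and exponent combined *)

Unset Implicit Arguments.
Set Strict Implicit.

Theorem corollary4p13
  (R : realType) (d : measure_display) (T : measurableType d)
  (P0 P1 : probability T R) (F : nat -> set (set T))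
  (E : nat -> T -> \bar R) (c : nat -> T -> R)
  (t : nat) (alpha C a K w0 : R) (Kn wn : nat -> R)
  (hF : is_filtration F)
  (hdom : locally_dominated P1 P0 F)
  (hE : is_betting_sequence P0 F E)
  (hc : is_drift_certificate P1 F E c)
  (ht : (0 < t)%N)
  (halpha : 0 < alpha < 1)
  (hC : {ae P1, forall w, C <= \sum_(1 <= n < t.+1) c n w})
  (ha : 0 < a)
  (hKn : forall n, (0 < n)%N -> 0 <= Kn n)
  (hwn : forall n, (0 < n)%N -> 0 <= wn n)
  (htail : forall n, (0 < n)%N -> forall x, 0 <= x ->
    {ae P1, forall w,
      (cond_probability P1 (F n.-1)
         [set w' | log_increment E n w' <= (c n w' - x)%:E] w
       <= (Kn n * expR (- (a * x)))%:E)%E})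
  (hsq : forall n, (0 < n)%N ->
    {ae P1, forall w,
      (cond_expectation P1 (F n.-1)
         (fun w' => (log_increment E n w' - (c n w')%:E) ^+ 2) w
       <= (wn n)%:E)%E})
  (hK : \sum_(1 <= n < t.+1) Kn n <= K)
  (hw0 : \sum_(1 <= n < t.+1) wn n <= w0) :
  let psi := fun n s (_ : T) => tail_series (wn n) (Kn n) a s in
  let Psi := tail_closed w0 K a in
  let Delta := excess_drift C alpha in
  let exponent := tail_exponent w0 K a Delta in
  [/\ [/\ forall n s w, (0 < n)%N -> 0 <= s < a ->
            psi n s w = (tail_closed (wn n) (Kn n) a s)%:E,
          is_majorant P1 F E c a%:E psi,
          forall s w, 0 <= s < a ->
            (\sum_(1 <= n < t.+1) psi n s w <= (Psi s)%:E)%E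
        & is_aggregate P1 c a%:E psi t C (EFin \o Psi)],
      (late_probability P1 E alpha t <= miss_probability P1 E alpha t)%E /\
        (miss_probability P1 E alpha t <= expeR (- exponent))%E,
      0 < Delta -> 0 < K ->
        exists u : R,
          unique (fun v : R => 0 < v < 1 /\
            a * w0 * v + K / a * (v ^+ 2 * (3 - 2 * v) / (1 - v) ^+ 2) = Delta) u
          /\ exponent = (a * u * Delta - Psi (a * u))%:E
    & (0 < w0 -> Delta <= a * w0 / 2 ->
         ((Delta ^+ 2 / (2 * w0) *
           (1 - 4 * K * Delta / (a ^+ 3 * w0 ^+ 2)))%:E <= exponent)%E) /\
      (K < a * Delta ->
         ((a * Delta - 2 * Num.sqrt (K * a * Delta) - a ^+ 2 * w0 / 2)%:E
           <= exponent)%E)].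
Proof.
move=> psi Psi Delta exponent.
have [sF FT Fmono F0] := hF; have /andP[al0 _] := halpha.
have E0 n w : (0 < n)%N -> (0 <= E n w)%E by move=> /hE[].
have mE n : (0 < n)%N -> measurable_wrt (F n) (E n) by move=> /hE[].
have mc n : (0 < n)%N -> measurable_wrt (F n.-1) (c n) by move=> /hc[].
have cL n : (0 < n)%N -> {ae P1, forall w,
    ((c n w)%:E <= cond_expectation P1 (F n.-1) (log_increment E n) w)%E}.
  by move=> /hc[].
have mL n : (0 < n)%N -> measurable_fun [set: T] (log_increment E n).
  move=> n0; apply: measurableT_comp; first exact: measurable_lne.
  exact: (measurable_wrtW (sF n) (FT n) (mE n n0)).
have Lfin n (n0 : (0 < n)%N) := certified_increment_fin
  (sF n.-1) (FT n.-1) (mL n n0) (mc n n0) (hwn n n0) (hsq n n0).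
have step n s A (n0 : (0 < n)%N) (FA : F n.-1 A) (sa : 0 <= s < a) :=
  certified_exp_moment_le (sF n.-1) (FT n.-1) (mL n n0) (mc n n0)
    (hKn n n0) (hwn n n0) (htail n n0) (hsq n n0) (cL n n0) FA sa.
have cgf n s (n0 : (0 < n)%N) (sa : 0 <= s < a) :=
  certified_cgf_le (sF n.-1) (FT n.-1) (mL n n0) (mc n n0)
    (hKn n n0) (hwn n n0) (htail n n0) (hsq n n0) (cL n n0) sa.
have Kn_ge0 : 0 <= K.
  by apply: le_trans hK; rewrite big_nat; apply: sumr_ge0 => k /andP[/hKn].
have w0_ge0 : 0 <= w0.
  by apply: le_trans hw0; rewrite big_nat; apply: sumr_ge0 => k /andP[/hwn].
have Delta0 : 0 <= Delta by rewrite /Delta /excess_drift le_max lexx orbT.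
have psiE n s w : 0 <= s < a -> psi n s w = (tail_closed (wn n) (Kn n) a s)%:E.
  exact: tail_seriesE.
have sum_psi s w : 0 <= s < a ->
    (\sum_(1 <= n < t.+1) psi n s w <= (Psi s)%:E)%E.
  move=> sa; rewrite (eq_bigr (fun n => (tail_closed (wn n) (Kn n) a s)%:E)).
    by rewrite sumEFin lee_fin; exact: sum_tail_closed_le.
  by move=> n _; exact: psiE.
split.
- split=> [n s w _||//|].
  + exact: psiE.
  + move=> n n0; split=> [w|s s0 sa].
      by rewrite psiE ?lexx// /tail_closed !mul0r !expr0n/= !mulr0 !mul0r addr0.
    rewrite lte_fin in sa; have s0a : 0 <= s < a by rewrite s0.
    split.
    * by move=> w; rewrite psiE// lee_fin tail_closed_ge0 ?hwn ?hKn.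
    * exact: measurable_cst.
    * by apply: filterS (cgf n s n0 s0a) => w; rewrite psiE.
  + split=> // s s0 sa; rewrite lte_fin in sa.
    by apply: aeW => w; apply: sum_psi; rewrite s0.
- split; first exact: (late_le_miss P1 hF mE).
  have miss0 : (0 <= miss_probability P1 E alpha t)%E by exact: measure_ge0.
  (* Comparing logarithms moves the supremum to the bounding side, where it splits into one
     exponential Markov bound for each s. *)
  rewrite -[leLHS](@lneK R); last by rewrite in_itv/= miss0 leey.
  rewrite lee_expeR leeNr; apply: ge_ereal_sup => y [s /=].
  rewrite in_itv/= => sa <-; rewrite leeNr -EFinN.
  have /andP[s0 _] := sa.
  have tail_ge0 n : (0 < n)%N -> 0 <= tail_closed (wn n) (Kn n) a s.
    by move=> n0; rewrite tail_closed_ge0 ?hwn ?hKn.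
  have := miss_le_exp hF E0 mE mc Lfin s0 tail_ge0
    (fun n A n0 FA => step n s A n0 FA sa) al0 hC.
  move=> /le_lne /le_trans; apply; rewrite lne_EFin ?expR_gt0// expRK lee_fin.
  by rewrite lerN2 lerB// sum_tail_closed_le.
- move=> D0 K0; have [u u01 uD] := tail_slope_root w0_ge0 K0 ha D0.
  exists u; split; last by apply: tail_exponent_attained => //; exact: ltW.
  split=> [//|v [v01 vD]].
  by apply: (tail_slope_inj w0_ge0 K0 ha u01 v01); rewrite uD.
- split=> [wpos DaW|KaD].
  + exact: tail_exponent_small_ge.
  + exact: tail_exponent_large_ge.
Qed.
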